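(* Let $(S,\mathcal F)$ be a sheaved space with values in $\mathcal V$ and let $(T,\mathcal G)$ be a core of $(S,\mathcal F)$. Then the canonical inclusion $T\hookrightarrow S$ induces a natural isomorphism $$H^{j}(X_T,\mathcal G)\;\cong\; H^{j}(X_S,\mathcal F)\qquad\text{for all } j\ge 0.$$
   Context: $\mathcal V$ is an abelian category with enough injectives (e.g. abelian groups, or vector spaces over a field). For a finite poset $S$, $X_S$ denotes $S$ with the Alexandrov topology, whose open sets are the upper sets. Sheaves on $X_S$ with values in $\mathcal V$ are identified with functors $\mathcal F: S\to\mathcal V$ (an object $\mathcal F(s)$ for each $s\in S$ and compatible restriction morphisms $\mathrm{res}^{s}_{t}:\mathcal F(s)\to\mathcal F(t)$ for $s\le t$). A sheaved space is a pair $(S,\mathcal F)$ with $S$ a finite poset and $\mathcal F$ such a sheaf. For $S'\subseteq S$ with the induced order, $\mathcal F|_{S'}$ is the restriction of the functor $\mathcal F$ to $S'$. Global sections are $\Gamma(S,\mathcal F)=\lim_{s\in S}\mathcal F(s)$, and $H^j(X_S,\mathcal F)$ is the $j$-th right derived functor of $\Gamma(S,-)$ applied to $\mathcal F$. An inclusion $T\hookrightarrow S$ of a subposet induces maps $H^j(X_S,\mathcal F)\to H^j(X_T,\mathcal F|_{T})$ (extending the restriction map $\Gamma(S,\mathcal F)\to\Gamma(T,\mathcal F|_{T})$ in degree $0$ to a map of $\delta$-functors). Beat elements of $(S,\mathcal F)$: an element $s\in S$ is a downbeat if there is $a<s$ such that every $b<s$ satisfies $b\le a$. It is an upbeat if there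 is $a>s$ such that every $b>s$ satisfies $b\ge a$, and moreover $\mathrm{res}^{s}_{a}:\mathcal F(s)\to\mathcal F(a)$ is an isomorphism. It is a beat element if it is an upbeat or a downbeat. A sheaved space is a core if it has no beat elements. $(T,\mathcal G)$ is a core of $(S,\mathcal F)$ if it is a core and can be obtained from $(S,\mathcal F)$ by a finite (possibly empty) sequence of consecutive deletions of beat elements, each step replacing $(R,\mathcal H)$ by $(R\setminus\{v\},\mathcal H|_{R\setminus\{v\}})$ with $v$ a beat element of $(R,\mathcal H)$; in particular $T\subseteq S$ and $\mathcal G=\mathcal F|_T$. *)

(* Defs.v *)
From HB Require Import structures.
From mathcomp Require Import all_boot all_order all_algebra.
From mathcomp Require Import boolp.

Set Implicit Arguments.
Unset Strict Implicit.
Unset Printing Implicit Defensive.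

Import Order.TTheory GRing.Theory.
Local Open Scope ring_scope.

(* Hom-sets are compared with Leibniz equality; the choice structure carried
   by a zmodType is no restriction, see [boolp.gen_choiceMixin]. *)
Record preadditive := Preadditive {
  ob :> Type;
  hom : ob -> ob -> zmodType;
  idm : forall x, hom x x;
  comp : forall x y z, hom y z -> hom x y -> hom x z;
  comp1m : forall x y (f : hom x y), comp (idm y) f = f;
  compm1 : forall x y (f : hom x y), comp f (idm x) = f;
  compA : forall x y z w (h : hom z w) (g : hom y z) (f : hom x y),
    comp h (comp g f) = comp (comp h g) f;
  compDl : forall x y z (g g' : hom y z) (f : hom x y),
    comp (g + g') f = comp g f + comp g' f;
  compDr : forall x y z (g : hom y z) (f f' : hom x y),
    comp g (f + f') = comp g f + comp g f' }.

Arguments hom {p} x y.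
Arguments idm {p} x.
Arguments comp {p x y z} g f.

Notation "g ∘ f" := (comp g f) (at level 40, left associativity) : ring_scope.

Section Preadditive.
Variable C : preadditive.
Implicit Types x y z w : C.

Definition mono x y (f : hom x y) : Prop :=
  forall w (g h : hom w x), f ∘ g = f ∘ h -> g = h.

Definition epi x y (f : hom x y) : Prop :=
  forall w (g h : hom y w), g ∘ f = h ∘ f -> g = h.

Definition is_iso x y (f : hom x y) : Prop :=
  exists g : hom y x, g ∘ f = idm x /\ f ∘ g = idm y.

Definition zero_object z : Prop :=
  forall x, (forall f : hom x z, f = 0) /\ (forall f : hom z x, f = 0).

Definition is_product x y p (p1 : hom p x) (p2 : hom p y) : Prop :=
  forall w (f : hom w x) (g : hom w y),
    exists! u : hom w p, p1 ∘ u = f /\ p2 ∘ u = g.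

Definition is_kernel x y k (f : hom x y) (i : hom k x) : Prop :=
  f ∘ i = 0 /\
  forall w (g : hom w x), f ∘ g = 0 -> exists! u : hom w k, i ∘ u = g.

Definition is_cokernel x y q (f : hom x y) (c : hom y q) : Prop :=
  c ∘ f = 0 /\
  forall w (g : hom y w), g ∘ f = 0 -> exists! u : hom q w, u ∘ c = g.

Definition exact x y z (f : hom x y) (g : hom y z) : Prop :=
  exists k (i : hom k y) (e : hom x k), [/\ is_kernel g i, epi e & i ∘ e = f].

Definition short_exact x y z (f : hom x y) (g : hom y z) : Prop :=
  is_kernel g f /\ is_cokernel f g.

Definition injective_object i : Prop :=
  forall x y (m : hom x y), mono m ->
    forall f : hom x i, exists g : hom y i, g ∘ m = f.

Record abelian : Prop := Abelian {
  ab_zero : exists z, zero_object z;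
  ab_prod : forall x y, exists p (p1 : hom p x) (p2 : hom p y),
    is_product p1 p2;
  ab_ker : forall x y (f : hom x y), exists k (i : hom k x), is_kernel f i;
  ab_coker : forall x y (f : hom x y), exists q (c : hom y q), is_cokernel f c;
  ab_mono : forall x y (f : hom x y), mono f ->
    exists z (g : hom y z), is_kernel g f;
  ab_epi : forall x y (f : hom x y), epi f ->
    exists z (g : hom z x), is_cokernel g f }.

Definition enough_injectives : Prop :=
  forall x, exists i (m : hom x i), injective_object i /\ mono m.

End Preadditive.

Record abcat := Abcat {
  ab_cat :> preadditive;
  ab_abelian : abelian ab_cat;
  ab_enough : enough_injectives ab_cat }.

Record additive_functor (A B : preadditive) := AdditiveFunctor {
  fobj :> A -> B;
  fmap : forall x y, hom x y -> hom (fobj x) (fobj y);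
  fmap1 : forall x, fmap (idm x) = idm (fobj x);
  fmapM : forall x y z (g : hom y z) (f : hom x y),
    fmap (g ∘ f) = fmap g ∘ fmap f;
  fmapD : forall x y (f g : hom x y), fmap (f + g) = fmap f + fmap g }.

Section PreadditiveTheory.
Variable C : preadditive.
Implicit Types x y z w : C.

Lemma compm0 x y z (g : hom y z) : g ∘ (0 : hom x y) = 0.
Proof. by apply: (addrI (g ∘ 0)); rewrite -compDr !addr0. Qed.

Lemma comp0m x y z (f : hom x y) : (0 : hom y z) ∘ f = 0.
Proof. by apply: (addrI (0 ∘ f)); rewrite -compDl !addr0. Qed.

Lemma compmN x y z (g : hom y z) (f : hom x y) : g ∘ (- f) = - (g ∘ f).
Proof. by apply: (addrI (g ∘ f)); rewrite -compDr !subrr compm0. Qed.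

Lemma compNm x y z (g : hom y z) (f : hom x y) : (- g) ∘ f = - (g ∘ f).
Proof. by apply: (addrI (g ∘ f)); rewrite -compDl !subrr comp0m. Qed.

Lemma compBr x y z (g : hom y z) (f f' : hom x y) :
  g ∘ (f - f') = g ∘ f - g ∘ f'.
Proof. by rewrite compDr compmN. Qed.

Lemma compBl x y z (g g' : hom y z) (f : hom x y) :
  (g - g') ∘ f = g ∘ f - g' ∘ f.
Proof. by rewrite compDl compNm. Qed.

Lemma monoP x y (f : hom x y) :
  (forall w (g : hom w x), f ∘ g = 0 -> g = 0) -> mono f.
Proof.
move=> fP w g h fgh; apply/eqP; rewrite -subr_eq0; apply/eqP/fP.
by rewrite compBr fgh subrr.
Qed.

Lemma epiP x y (f : hom x y) :
  (forall w (g : hom y w), g ∘ f = 0 -> g = 0) -> epi f.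
Proof.
move=> fP w g h fgh; apply/eqP; rewrite -subr_eq0; apply/eqP/fP.
by rewrite compBl fgh subrr.
Qed.

Lemma is_kernel_mono x y k (f : hom x y) (i : hom k x) :
  is_kernel f i -> mono i.
Proof.
move=> [fi0 iU] w g h igh; have /iU[u [_ uU]] : f ∘ (i ∘ g) = 0.
  by rewrite compA fi0 comp0m.
by rewrite -(uU g) // -(uU h).
Qed.

Lemma is_cokernel_epi x y q (f : hom x y) (c : hom y q) :
  is_cokernel f c -> epi c.
Proof.
move=> [cf0 cU] w g h cgh; have /cU[u [_ uU]] : (g ∘ c) ∘ f = 0.
  by rewrite -compA cf0 compm0.
by rewrite -(uU g) // -(uU h).
Qed.

Lemma is_kernelI x y k (f : hom x y) (i : hom k x) : f ∘ i = 0 -> mono i ->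
  (forall w (g : hom w x), f ∘ g = 0 -> exists u : hom w k, i ∘ u = g) ->
  is_kernel f i.
Proof.
move=> fi0 im iU; split=> // w g /iU[u <-]; exists u.
by split=> // v /im.
Qed.

Lemma is_cokernelI x y q (f : hom x y) (c : hom y q) : c ∘ f = 0 -> epi c ->
  (forall w (g : hom y w), g ∘ f = 0 -> exists u : hom q w, u ∘ c = g) ->
  is_cokernel f c.
Proof.
move=> cf0 ce cU; split=> // w g /cU[u <-]; exists u.
by split=> // v /ce.
Qed.

End PreadditiveTheory.

Section AdditiveFunctorTheory.
Variables (A B : preadditive) (G : additive_functor A B).

Lemma fmap0 (x y : A) : fmap G (0 : hom x y) = 0.
Proof. by apply: (addrI (fmap G 0)); rewrite -fmapD !addr0. Qed.

Lemma fmapN (x y : A) (f : hom x y) : fmap G (- f) = - fmap G f.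
Proof. by apply: (addrI (fmap G f)); rewrite -fmapD !subrr fmap0. Qed.

End AdditiveFunctorTheory.

Section AbelianTheory.
Variable C : preadditive.
Hypothesis abC : abelian C.
Implicit Types x y z w : C.

Lemma mono_is_kernel x y q (m : hom x y) (c : hom y q) :
  mono m -> is_cokernel m c -> is_kernel c m.
Proof.
move=> mm [cm0 cU]; apply: is_kernelI => // w g cg0.
have [z [f [fm0 fU]]] := ab_mono abC mm.
have [u [uc _]] := cU _ _ fm0.
have [|v [mv _]] := fU w g; first by rewrite -uc -compA cg0 compm0.
by exists v.
Qed.

Lemma epi_is_cokernel x y k (e : hom x y) (i : hom k x) :
  epi e -> is_kernel e i -> is_cokernel i e.
Proof.
move=> ee [ei0 iU]; apply: is_cokernelI => // w g gi0.
have [z [f [ef0 fU]]] := ab_epi abC ee.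
have [u [iu _]] := iU _ _ ef0.
have [|v [ve _]] := fU w g; first by rewrite -iu compA gi0 comp0m.
by exists v.
Qed.

Lemma coimage_mono x y k q (g : hom x y) (i : hom k x) (c : hom x q)
    (m : hom q y) :
  is_kernel g i -> is_cokernel i c -> m ∘ c = g -> mono m.
Proof.
move=> [gi0 iU] cK mcg; have [ci0 cU] := cK; apply: monoP => w f mf0.
have [r [p pK]] := ab_coker abC f; have [pf0 pU] := pK.
have [m' [m'p _]] := pU _ _ mf0.
have pce : epi (p ∘ c).
  move=> t a b; rewrite !compA => /(is_cokernel_epi cK).
  exact: (is_cokernel_epi pK).
have [z [h [pch0 hU]]] := ab_epi abC pce.
have [|l [il _]] := iU _ h.
  by rewrite -mcg -m'p -!compA [p ∘ (c ∘ h)]compA pch0 compm0.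
have [|s [sp _]] := hU _ c; first by rewrite -il compA ci0 comp0m.
have sp1 : s ∘ p = idm q.
  by apply: (is_cokernel_epi cK); rewrite comp1m -compA.
by rewrite -[f]comp1m -sp1 -compA pf0 compm0.
Qed.

Lemma exact_extend x y z i (f : hom x y) (g : hom y z) (u : hom y i) :
  injective_object i -> exact f g -> u ∘ f = 0 ->
  exists v : hom z i, v ∘ g = u.
Proof.
move=> iI [k [j [e [jK ee <-]]]] uf0.
have [q [c cK]] := ab_coker abC j.
have [m [mc _]] := cK.2 _ _ jK.1.
have uj0 : u ∘ j = 0 by apply: ee; rewrite -compA uf0 comp0m.
have [u' [u'c _]] := cK.2 _ _ uj0.
have [v vm] := iI _ _ m (coimage_mono jK cK mc) u'.
by exists v; rewrite -mc compA vm.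
Qed.

Lemma kernel_exact x y z (f : hom x y) (g : hom y z) :
  is_kernel g f -> exact f g.
Proof.
move=> fK; exists x, f, (idm x); split=> //; last by rewrite compm1.
by move=> w a b; rewrite !compm1.
Qed.

Lemma finite_product (I : finType) (X : I -> C) :
  exists p (pi : forall i, hom p (X i)), forall w (c : forall i, hom w (X i)),
    exists! u : hom w p, forall i, pi i ∘ u = c i.
Proof.
suff [p [pi piU]] : exists p (pi : forall i, hom p (X i)),
    forall w (c : forall i, hom w (X i)),
    exists! u : hom w p, forall i, i \in enum I -> pi i ∘ u = c i.
  exists p, pi => w c; have [u [uc uU]] := piU w c; exists u.
  split=> [i|v vc]; first by rewrite uc // mem_enum.
  by apply: uU => i _.
elim: (enum I) => [|j s [p [pi piU]]].
  have [z z0] := ab_zero abC; exists z, (fun=> 0) => w c; exists 0.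
  by split=> // v _; rewrite ((z0 w).1 v).
have [js|jNs] := boolP (j \in s).
  exists p, pi => w c; have [u [uc uU]] := piU w c; exists u.
  split=> [i|v vc]; first by rewrite inE => /orP[/eqP->|]; apply: uc.
  by apply: uU => i si; apply: vc; rewrite inE si orbT.
have [q [q1 [q2 qU]]] := ab_prod abC p (X j).
pose rho i : hom q (X i) :=
  match j =P i with
  | ReflectT e => ecast i (hom q (X i)) e q2
  | ReflectF _ => pi i ∘ q1
  end.
have rhoj : rho j = q2 by rewrite /rho; case: eqP => // e; rewrite eq_axiomK.
have rhoN i : i \in s -> rho i = pi i ∘ q1.
  by move=> si; rewrite /rho; case: eqP => // ji; case/negP: jNs; rewrite ji.
exists q, rho => w c; have [u [uc uU]] := piU w c.
have [v [[v1 v2] vU]] := qU w u (c j); exists v; split.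
  move=> i; rewrite inE; have [->|_] /= := eqVneq i j; first by rewrite rhoj.
  by move=> si; rewrite rhoN // -compA v1 uc.
move=> v' v'c; apply: vU; split.
  by apply/esym/uU => i si; rewrite compA -rhoN // v'c // inE si orbT.
by rewrite -rhoj v'c // mem_head.
Qed.

End AbelianTheory.

Section Chosen.
Variable C : abcat.
Implicit Types x y z w : C.

Definition ker_ob x y (f : hom x y) : C :=
  sval (cid (ab_ker (ab_abelian C) f)).

Definition ker_inc x y (f : hom x y) : hom (ker_ob f) x :=
  sval (cid (svalP (cid (ab_ker (ab_abelian C) f)))).

Lemma ker_incP x y (f : hom x y) : is_kernel f (ker_inc f).
Proof. exact: svalP (cid (svalP (cid (ab_ker (ab_abelian C) f)))). Qed.

Definition ker_lift x y w (f : hom x y) (g : hom w x) (fg0 : f ∘ g = 0) :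
    hom w (ker_ob f) :=
  sval (cid ((ker_incP f).2 w g fg0)).

Lemma ker_liftK x y w (f : hom x y) (g : hom w x) (fg0 : f ∘ g = 0) :
  ker_inc f ∘ ker_lift fg0 = g.
Proof. exact: (svalP (cid ((ker_incP f).2 w g fg0))).1. Qed.

Definition coker_ob x y (f : hom x y) : C :=
  sval (cid (ab_coker (ab_abelian C) f)).

Definition coker_proj x y (f : hom x y) : hom y (coker_ob f) :=
  sval (cid (svalP (cid (ab_coker (ab_abelian C) f)))).

Lemma coker_projP x y (f : hom x y) : is_cokernel f (coker_proj f).
Proof. exact: svalP (cid (svalP (cid (ab_coker (ab_abelian C) f)))). Qed.

Definition inj_ob x : C := sval (cid (ab_enough x)).

Definition inj_emb x : hom x (inj_ob x) :=
  sval (cid (svalP (cid (ab_enough x)))).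

Lemma inj_embP x : injective_object (inj_ob x) /\ mono (inj_emb x).
Proof. exact: svalP (cid (svalP (cid (ab_enough x)))). Qed.

End Chosen.

Record complex (A : preadditive) := Complex {
  cx_ob :> nat -> A;
  cx_d : forall n, hom (cx_ob n) (cx_ob n.+1);
  cx_dd : forall n, cx_d n.+1 ∘ cx_d n = 0 }.

Record injective_resolution (A : preadditive) (x : A) := InjectiveResolution {
  ir_cx :> complex A;
  ir_aug : hom x (ir_cx 0);
  ir_injective : forall n, injective_object (ir_cx n);
  ir_exact0 : is_kernel (cx_d ir_cx 0) ir_aug;
  ir_exact : forall n, exact (cx_d ir_cx n) (cx_d ir_cx n.+1) }.

Section Resolution.
Variables (A : abcat) (x : A).

Definition syzygy n : A := iter n (fun y => coker_ob (inj_emb y)) x.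

Definition res_d n : hom (inj_ob (syzygy n)) (inj_ob (syzygy n.+1)) :=
  inj_emb (syzygy n.+1) ∘ coker_proj (inj_emb (syzygy n)).

Lemma res_d_kernel n : is_kernel (res_d n) (inj_emb (syzygy n)).
Proof.
have em := (inj_embP (syzygy n)).2.
have [ce0 eU] := mono_is_kernel (ab_abelian A) em (coker_projP _).
split=> [|w g]; first by rewrite -compA ce0 compm0.
rewrite -compA => dg0; apply: eU; apply: (inj_embP (syzygy n.+1)).2.
by rewrite dg0 compm0.
Qed.

Lemma res_dd n : res_d n.+1 ∘ res_d n = 0.
Proof. by rewrite [res_d n]/res_d compA (res_d_kernel n.+1).1 comp0m. Qed.

Lemma res_exact n : exact (res_d n) (res_d n.+1).
Proof.
exists (syzygy n.+1), (inj_emb _), (coker_proj _); split=> //.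
  exact: res_d_kernel.
exact: is_cokernel_epi (coker_projP _).
Qed.

Definition resolution : injective_resolution x :=
  @InjectiveResolution A x (Complex res_dd) (inj_emb x)
    (fun n => (inj_embP (syzygy n)).1) (res_d_kernel 0) res_exact.

End Resolution.

Lemma comparison (A : abcat) (x y : A) (I : injective_resolution x)
    (K : complex A) (eta : hom y (K 0)) (f : hom x y) :
    cx_d K 0 ∘ eta = 0 -> (forall n, injective_object (K n)) ->
  exists phi : forall n, hom (I n) (K n),
    phi 0 ∘ ir_aug I = eta ∘ f /\
    forall n, phi n.+1 ∘ cx_d I n = cx_d K n ∘ phi n.
Proof.
move=> deta0 Kinj.
pose src n : A := if n is n'.+1 then I n' else x.
pose inc n : hom (src n) (I n) :=
  if n is n'.+1 then cx_d I n' else ir_aug I.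
have incE n : exact (inc n) (cx_d I n).
  by case: n => [|n]; [exact: kernel_exact (ir_exact0 I)|exact: ir_exact].
pose T n := {u : hom (I n) (K n) | cx_d K n ∘ u ∘ inc n = 0}.
have step n (u : T n) : {v : T n.+1 | sval v ∘ cx_d I n = cx_d K n ∘ sval u}.
  case: u => u u0.
  have [v vE] := cid (exact_extend (ab_abelian A) (Kinj n.+1) (incE n) u0).
  suff v0 : cx_d K n.+1 ∘ v ∘ inc n.+1 = 0 by exists (exist _ v v0).
  by rewrite -compA /= vE compA cx_dd comp0m.
have start : {v : T 0%N | sval v ∘ ir_aug I = eta ∘ f}.
  have [v vE] := cid (Kinj 0%N _ _ _ (is_kernel_mono (ir_exact0 I)) (eta ∘ f)).
  suff v0 : cx_d K 0 ∘ v ∘ inc 0%N = 0 by exists (exist _ v v0).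
  by rewrite -compA /= vE compA deta0 comp0m.
pose phi := nat_rect T (sval start) (fun n u => sval (step n u)).
exists (fun n => sval (phi n)); split; first exact: svalP start.
by move=> n; exact: svalP (step n (phi n)).
Qed.

Section Cohomology.
Variable B : abcat.

(* The differential entering degree [j]; in degree [0] it is zero, with an
   arbitrary source. *)
Definition cx_din (X : complex B) (j : nat) : hom (X j.-1) (X j) :=
  if j is i.+1 then cx_d X i else 0.

Lemma cx_d_din (X : complex B) j : cx_d X j ∘ cx_din X j = 0.
Proof. by case: j => [|j]; [exact: compm0|exact: cx_dd]. Qed.

Definition coh_ob (X : complex B) (j : nat) : B :=
  coker_ob (ker_lift (cx_d_din X j)).

Definition coh_proj (X : complex B) (j : nat) :
    hom (ker_ob (cx_d X j)) (coh_ob X j) :=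
  coker_proj (ker_lift (cx_d_din X j)).

(* [h] sends the class of a cocycle [z] to the class of the cocycle [f z]. *)
Definition coh_induced (X Y : complex B) (j k : nat) (f : hom (X j) (Y k))
    (h : hom (coh_ob X j) (coh_ob Y k)) : Prop :=
  exists g : hom (ker_ob (cx_d X j)) (ker_ob (cx_d Y k)),
    ker_inc (cx_d Y k) ∘ g = f ∘ ker_inc (cx_d X j) /\
    h ∘ coh_proj X j = coh_proj Y k ∘ g.

Lemma coh_induced_uniq (X Y : complex B) j k (f : hom (X j) (Y k)) h h' :
  coh_induced f h -> coh_induced f h' -> h = h'.
Proof.
move=> [g [gf hg]] [g' [gf' hg']]; apply: (is_cokernel_epi (coker_projP _)).
rewrite [LHS]hg [RHS]hg'; congr (_ ∘ _).
by apply: (is_kernel_mono (ker_incP _)); rewrite gf.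
Qed.

Lemma coh_induced_ex (X Y : complex B) j k (f : hom (X j) (Y k))
    (f' : hom (X j.+1) (Y k.+1)) (b : hom (X j.-1) (Y k.-1)) :
    cx_d Y k ∘ f = f' ∘ cx_d X j -> f ∘ cx_din X j = cx_din Y k ∘ b ->
  exists h, coh_induced f h.
Proof.
move=> ff' fb.
have f0 : cx_d Y k ∘ (f ∘ ker_inc (cx_d X j)) = 0.
  by rewrite compA ff' -compA (ker_incP _).1 compm0.
pose g := ker_lift f0; have gE := ker_liftK f0.
have pg0 : coh_proj Y k ∘ g ∘ ker_lift (cx_d_din X j) = 0.
  suff -> : coh_proj Y k ∘ g ∘ ker_lift (cx_d_din X j) =
            coh_proj Y k ∘ (ker_lift (cx_d_din Y k) ∘ b).
    by rewrite compA (coker_projP _).1 comp0m.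
  rewrite -compA; congr (_ ∘ _); apply: (is_kernel_mono (ker_incP _)).
  by rewrite !compA gE !ker_liftK -compA ker_liftK fb.
have [h [hE _]] := (coker_projP (ker_lift (cx_d_din X j))).2 _ _ pg0.
by exists h, g.
Qed.

End Cohomology.

Section RightDerived.
Variables (A B : abcat) (G : additive_functor A B).

Lemma fmap_dd (X : complex A) n :
  fmap G (cx_d X n.+1) ∘ fmap G (cx_d X n) = 0.
Proof. by rewrite -fmapM cx_dd fmap0. Qed.

Definition fmap_cx (X : complex A) : complex B :=
  @Complex B (fun n => G (X n)) (fun n => fmap G (cx_d X n)) (fmap_dd X).

(* Any two injective resolutions being homotopy equivalent, nothing below
   depends on the choice of [resolution x], up to canonical isomorphism. *)
Definition rderived (j : nat) (x : A) : B :=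
  coh_ob (fmap_cx (resolution x)) j.

Lemma fmap_aug x : fmap G (cx_d (resolution x) 0) ∘
  fmap G (ir_aug (resolution x)) = 0.
Proof. by rewrite -fmapM (ir_exact0 _).1 fmap0. Qed.

Definition rderived_unit (x : A) : hom (G x) (rderived 0 x) :=
  coh_proj (fmap_cx (resolution x)) 0 ∘
  @ker_lift B _ _ _ (cx_d (fmap_cx (resolution x)) 0) _ (fmap_aug x).

Definition is_rderived_map (j : nat) (x y : A) (f : hom x y)
    (h : hom (rderived j x) (rderived j y)) : Prop :=
  exists phi : forall n, hom (resolution x n) (resolution y n),
  [/\ phi 0%N ∘ ir_aug (resolution x) = ir_aug (resolution y) ∘ f,
      forall n, phi n.+1 ∘ cx_d (resolution x) n =
                cx_d (resolution y) n ∘ phi n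
    & @coh_induced B (fmap_cx (resolution x)) (fmap_cx (resolution y)) j j
        (fmap G (phi j)) h].

Lemma rderived_map_ex j x y (f : hom x y) : exists h, is_rderived_map (j := j) f h.
Proof.
have [phi [phi0 phiS]] := comparison (resolution x) f
  (ir_exact0 (resolution y)).1 (@ir_injective _ _ (resolution y)).
have [||h hP] := @coh_induced_ex B (fmap_cx (resolution x))
  (fmap_cx (resolution y)) j j (fmap G (phi j)) (fmap G (phi j.+1))
  (fmap G (phi j.-1)).
- by rewrite /= -!fmapM phiS.
- by case: j => [|j] /=; rewrite ?comp0m ?compm0 // -!fmapM phiS.
by exists h, phi.
Qed.

Definition rderived_map j x y (f : hom x y) :
    hom (rderived j x) (rderived j y) :=
  sval (cid (rderived_map_ex j f)).

(* For a short exact sequence [0 -> x -> y -> z -> 0] with maps [f], [g], and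
   the chosen resolutions [I] of [x] and [J] of [z], a pair [(e, tau)] as below
   amounts to a horseshoe resolution of [y]: its terms are the sums
   [I n + J n], its differential is [(a, c) |-> (d a + tau c, d c)] and its
   augmentation is [(e, aug \o g)].  In the degreewise split short exact
   sequence [0 -> G I -> G (I + J) -> G J -> 0], a cocycle [c] of [G J] lifts to
   [(0, c)], whose differential is [tau c]; thus the connecting morphism given
   by the snake lemma is the one induced by [tau]. *)
Definition is_connecting (j : nat) (x y z : A) (f : hom x y) (g : hom y z)
    (h : hom (rderived j z) (rderived j.+1 x)) : Prop :=
  exists (e : hom y (resolution x 0))
    (tau : forall n, hom (resolution z n) (resolution x n.+1)),
  [/\ e ∘ f = ir_aug (resolution x),
      cx_d (resolution x) 0 ∘ e + tau 0%N ∘ (ir_aug (resolution z) ∘ g) = 0,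
      forall n, cx_d (resolution x) n.+1 ∘ tau n +
                tau n.+1 ∘ cx_d (resolution z) n = 0
    & @coh_induced B (fmap_cx (resolution z)) (fmap_cx (resolution x)) j j.+1
        (fmap G (tau j)) h].

Lemma connecting_ex j x y z (f : hom x y) (g : hom y z) :
  short_exact f g -> exists h, is_connecting (j := j) f g h.
Proof.
move=> [fK gK]; pose I := resolution x.
have [e ef] := @ir_injective _ _ I 0%N _ _ _ (is_kernel_mono fK) (ir_aug I).
have def0 : - (cx_d I 0 ∘ e) ∘ f = 0.
  by rewrite compNm -compA ef (ir_exact0 I).1 oppr0.
have [u [ug _]] := gK.2 _ _ def0.
have dd n : - cx_d I n.+2 ∘ - cx_d I n.+1 = 0.
  by rewrite compNm compmN opprK cx_dd.
pose K := @Complex A (fun n => I n.+1) (fun n => - cx_d I n.+1) dd.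
have [|n|tau [tau0 tauS]] :=
  @comparison A z z (resolution z) K u (idm z).
- apply: (is_cokernel_epi gK); rewrite comp0m -compA ug.
  by rewrite compNm compmN opprK compA cx_dd comp0m.
- exact: ir_injective.
have tau0E : cx_d I 0 ∘ e + tau 0%N ∘ (ir_aug (resolution z) ∘ g) = 0.
  by rewrite compA tau0 compm1 ug subrr.
have tauSE n : cx_d I n.+1 ∘ tau n + tau n.+1 ∘ cx_d (resolution z) n = 0.
  by rewrite tauS /= compNm subrr.
have [||h hP] := @coh_induced_ex B (fmap_cx (resolution z)) (fmap_cx I) j j.+1
  (fmap G (tau j)) (- fmap G (tau j.+1))
  (if j is i.+1 then - fmap G (tau i) else 0).
- rewrite /= compNm -!fmapM; apply/eqP; rewrite -addr_eq0 -fmapD.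
  by rewrite tauSE fmap0.
- case: j => [|j] /=; first by rewrite !compm0.
  rewrite compmN -!fmapM; apply/eqP; rewrite -addr_eq0 addrC -fmapD.
  by rewrite tauSE fmap0.
by exists h, e, tau.
Qed.

Definition connecting j x y z (f : hom x y) (g : hom y z)
    (fg : short_exact f g) : hom (rderived j z) (rderived j.+1 x) :=
  sval (cid (connecting_ex j fg)).

End RightDerived.

Section Sheaf.
Context {disp : Order.disp_t}.
Variables (S : finPOrderType disp) (V : preadditive).

(* A sheaf on [S] with the Alexandrov topology whose open sets are the upper
   sets, given by its stalks, i.e. its sections over the least open sets. *)
Record sheaf := Sheaf {
  stalk :> S -> V;
  res : forall s t, (s <= t)%O -> hom (stalk s) (stalk t);
  res1 : forall s (ss : (s <= s)%O), res ss = idm (stalk s);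
  resM : forall s t u (st : (s <= t)%O) (tu : (t <= u)%O) (su : (s <= u)%O),
    res tu ∘ res st = res su }.

Record sheaf_hom (F G : sheaf) := SheafHom {
  sh_map :> forall s, hom (F s) (G s);
  sh_nat : forall s t (st : (s <= t)%O),
    sh_map t ∘ res F st = res G st ∘ sh_map s }.

Lemma sheaf_homP F G (a b : sheaf_hom F G) : (forall s, a s = b s) -> a = b.
Proof.
case: a b => [a an] [b bn] /= ab.
have {}ab : a = b by apply: functional_extensionality_dep.
by subst b; congr SheafHom; exact: Prop_irrelevance.
Qed.

HB.instance Definition _ F G := gen_eqMixin (sheaf_hom F G).
HB.instance Definition _ F G := gen_choiceMixin (sheaf_hom F G).

Section SheafHomZmod.
Variables F G : sheaf.

Definition sh0 : sheaf_hom F G.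
Proof. by exists (fun=> 0) => s t st; rewrite compm0 comp0m. Defined.

Definition shN (a : sheaf_hom F G) : sheaf_hom F G.
Proof. by exists (fun s => - a s) => s t st; rewrite compmN compNm sh_nat. Defined.

Definition shD (a b : sheaf_hom F G) : sheaf_hom F G.
Proof.
by exists (fun s => a s + b s) => s t st; rewrite compDl compDr !sh_nat.
Defined.

Lemma shDA : associative shD.
Proof. by move=> a b c; apply: sheaf_homP => s; exact: addrA. Qed.

Lemma shDC : commutative shD.
Proof. by move=> a b; apply: sheaf_homP => s; exact: addrC. Qed.

Lemma sh0D : left_id sh0 shD.
Proof. by move=> a; apply: sheaf_homP => s; exact: add0r. Qed.

Lemma shND : left_inverse sh0 shN shD.
Proof. by move=> a; apply: sheaf_homP => s; exact: addNr. Qed.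

HB.instance Definition _ :=
  GRing.isZmodule.Build (sheaf_hom F G) shDA shDC sh0D shND.

End SheafHomZmod.

Definition sh_id F : sheaf_hom F F.
Proof. by exists (fun s => idm (F s)) => s t st; rewrite comp1m compm1. Defined.

Definition sh_comp F G H (b : sheaf_hom G H) (a : sheaf_hom F G) :
  sheaf_hom F H.
Proof.
exists (fun s => b s ∘ a s) => s t st.
by rewrite -compA sh_nat compA sh_nat compA.
Defined.

Definition sheaf_precat : preadditive.
Proof.
refine (@Preadditive sheaf (fun F G => sheaf_hom F G : zmodType) sh_id sh_comp
  _ _ _ _ _).
- by move=> F G a; apply: sheaf_homP => s; exact: comp1m.
- by move=> F G a; apply: sheaf_homP => s; exact: compm1.
- by move=> F G H K c b a; apply: sheaf_homP => s; exact: compA.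
- by move=> F G H b b' a; apply: sheaf_homP => s; exact: compDl.
- by move=> F G H b a a'; apply: sheaf_homP => s; exact: compDr.
Defined.

End Sheaf.

Arguments res {disp S V} F {s t} st : rename.

Section SheafAbelian.
Context {disp : Order.disp_t}.
Variables (S : finPOrderType disp) (V : abcat).
Local Notation sh := (sheaf_precat S V).
Implicit Types F G H : sh.

Lemma sh_ext F G (a b : hom F G) : (forall s, sh_map a s = sh_map b s) -> a = b.
Proof. exact: sheaf_homP. Qed.

Lemma sh_ker_subproof F G (a : hom F G) s t (st : (s <= t)%O) :
  sh_map a t ∘ (res F st ∘ ker_inc (sh_map a s)) = 0.
Proof. by rewrite compA sh_nat -compA (ker_incP _).1 compm0. Qed.

Definition sh_ker F G (a : hom F G) : sh.
Proof.
refine (@Sheaf _ S V (fun s => ker_ob (sh_map a s))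
  (fun s t st => ker_lift (sh_ker_subproof a st)) _ _).
- move=> s ss; apply: (is_kernel_mono (ker_incP _)).
  by rewrite ker_liftK res1 comp1m compm1.
- move=> s t u st tu su; apply: (is_kernel_mono (ker_incP _)).
  by rewrite compA !ker_liftK -compA ker_liftK compA (resM _ _ _ su).
Defined.

Definition sh_ker_inc F G (a : hom F G) : hom (sh_ker a) F.
Proof.
by exists (fun s => ker_inc (sh_map a s)) => s t st; rewrite ker_liftK.
Defined.

Lemma sh_kernelP F G K (a : hom F G) (i : hom K F) :
  (forall s, is_kernel (sh_map a s) (sh_map i s)) -> is_kernel a i.
Proof.
move=> iK; apply: is_kernelI.
- by apply: sh_ext => s; exact: (iK s).1.
- move=> H b b' ib; apply: sh_ext => s; apply: (is_kernel_mono (iK s)).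
  exact: (congr1 (fun c : sheaf_hom H F => c s) ib).
move=> H b ab0.
have ab0s s : sh_map a s ∘ sh_map b s = 0.
  exact: (congr1 (fun c : sheaf_hom H G => c s) ab0).
pose u s := sval (cid ((iK s).2 _ _ (ab0s s))).
have uE s : sh_map i s ∘ u s = sh_map b s.
  by rewrite /u; case: cid => v [].
suff un s t (st : (s <= t)%O) : u t ∘ res H st = res K st ∘ u s.
  by exists (SheafHom un : sheaf_hom H K); apply: sh_ext.
apply: (is_kernel_mono (iK t)).
by rewrite compA uE sh_nat -uE compA -sh_nat compA.
Qed.

Lemma sh_ker_incP F G (a : hom F G) : is_kernel a (sh_ker_inc a).
Proof. by apply: sh_kernelP => s; exact: ker_incP. Qed.

Lemma sh_mono_stalk F G (m : hom F G) s : mono m -> mono (sh_map m s).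
Proof.
move=> mm.
have i0 : sh_ker_inc m = 0.
  by apply: mm; rewrite compm0 (sh_ker_incP m).1.
have i0s : ker_inc (sh_map m s) = 0.
  exact: (congr1 (fun c : sheaf_hom (sh_ker m) F => c s) i0).
apply: monoP => w g mg0.
by rewrite -(ker_liftK mg0) i0s comp0m.
Qed.

Lemma sh_kernel_stalk F G K (a : hom F G) (i : hom K F) s :
  is_kernel a i -> is_kernel (sh_map a s) (sh_map i s).
Proof.
move=> iK; have [u [uE _]] := iK.2 _ _ (sh_ker_incP a).1.
apply: is_kernelI.
- exact: (congr1 (fun c : sheaf_hom K G => c s) iK.1).
- exact: sh_mono_stalk (is_kernel_mono iK).
move=> w g ag0; exists (sh_map u s ∘ ker_lift ag0); rewrite compA.
have -> : sh_map i s ∘ sh_map u s = ker_inc (sh_map a s).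
  exact: (congr1 (fun c : sheaf_hom (sh_ker a) F => c s) uE).
exact: ker_liftK.
Qed.

Lemma coker_desc_ex x y w (f : @hom V x y) (g : hom y w) :
  g ∘ f = 0 -> exists u : hom (coker_ob f) w, u ∘ coker_proj f = g.
Proof. by move=> /(coker_projP f).2[u []]; exists u. Qed.

Definition coker_desc x y w (f : @hom V x y) (g : hom y w) (gf0 : g ∘ f = 0) :
  hom (coker_ob f) w := sval (cid (coker_desc_ex gf0)).

Lemma coker_descK x y w (f : @hom V x y) (g : hom y w) (gf0 : g ∘ f = 0) :
  coker_desc gf0 ∘ coker_proj f = g.
Proof. exact: svalP (cid (coker_desc_ex gf0)). Qed.

Lemma sh_coker_subproof F G (a : hom F G) s t (st : (s <= t)%O) :
  coker_proj (sh_map a t) ∘ res G st ∘ sh_map a s = 0.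
Proof. by rewrite -compA -sh_nat compA (coker_projP _).1 comp0m. Qed.

Definition sh_coker F G (a : hom F G) : sh.
Proof.
refine (@Sheaf _ S V (fun s => coker_ob (sh_map a s))
  (fun s t st => coker_desc (sh_coker_subproof a st)) _ _).
- move=> s ss; apply: (is_cokernel_epi (coker_projP _)).
  by rewrite coker_descK res1 comp1m compm1.
- move=> s t u st tu su; apply: (is_cokernel_epi (coker_projP _)).
  by rewrite -compA !coker_descK compA coker_descK -compA (resM _ _ _ su).
Defined.

Definition sh_coker_proj F G (a : hom F G) : hom G (sh_coker a).
Proof.
by exists (fun s => coker_proj (sh_map a s)) => s t st; rewrite coker_descK.
Defined.

Lemma sh_cokernelP F G Q (a : hom F G) (c : hom G Q) :
  (forall s, is_cokernel (sh_map a s) (sh_map c s)) -> is_cokernel a c.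
Proof.
move=> cQ; apply: is_cokernelI.
- by apply: sh_ext => s; exact: (cQ s).1.
- move=> H b b' bc; apply: sh_ext => s; apply: (is_cokernel_epi (cQ s)).
  exact: (congr1 (fun c : sheaf_hom G H => c s) bc).
move=> H b ba0.
have ba0s s : sh_map b s ∘ sh_map a s = 0.
  exact: (congr1 (fun c : sheaf_hom F H => c s) ba0).
pose u s := sval (cid ((cQ s).2 _ _ (ba0s s))).
have uE s : u s ∘ sh_map c s = sh_map b s.
  by rewrite /u; case: cid => v [].
suff un s t (st : (s <= t)%O) : u t ∘ res Q st = res H st ∘ u s.
  by exists (SheafHom un : sheaf_hom Q H); apply: sh_ext.
apply: (is_cokernel_epi (cQ s)).
by rewrite -compA -sh_nat compA uE sh_nat -uE compA.
Qed.

Lemma sh_coker_projP F G (a : hom F G) : is_cokernel a (sh_coker_proj a).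
Proof. by apply: sh_cokernelP => s; exact: coker_projP. Qed.

Lemma sh_epi_stalk F G (e : hom F G) s : epi e -> epi (sh_map e s).
Proof.
move=> ee.
have c0 : sh_coker_proj e = 0.
  by apply: ee; rewrite comp0m (sh_coker_projP e).1.
have c0s : coker_proj (sh_map e s) = 0.
  exact: (congr1 (fun c : sheaf_hom G (sh_coker e) => c s) c0).
apply: epiP => w g ge0.
by rewrite -(coker_descK ge0) c0s compm0.
Qed.

Lemma sh_cokernel_stalk F G Q (a : hom F G) (c : hom G Q) s :
  is_cokernel a c -> is_cokernel (sh_map a s) (sh_map c s).
Proof.
move=> cQ; have [u [uE _]] := cQ.2 _ _ (sh_coker_projP a).1.
apply: is_cokernelI.
- exact: (congr1 (fun c : sheaf_hom F Q => c s) cQ.1).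
- exact: sh_epi_stalk (is_cokernel_epi cQ).
move=> w g ga0; exists (coker_desc ga0 ∘ sh_map u s); rewrite -compA.
have -> : sh_map u s ∘ sh_map c s = coker_proj (sh_map a s).
  exact: (congr1 (fun c : sheaf_hom G (sh_coker a) => c s) uE).
exact: coker_descK.
Qed.

Lemma sheaf_abelian : abelian sh.
Proof.
split.
- have [z z0] := ab_zero (ab_abelian V).
  exists (@Sheaf _ S V (fun=> z) (fun _ _ _ => idm z) (fun _ _ => erefl)
    (fun _ _ _ _ _ _ => comp1m _)) => F; split=> a; apply: sh_ext => s.
    exact: (z0 _).1.
  exact: (z0 _).2.
- move=> F G.
  pose P s := cid (ab_prod (ab_abelian V) (F s) (G s)).
  pose p s := sval (P s); pose Q s := cid (svalP (P s)).
  pose p1 s := sval (Q s) : hom (p s) (F s); pose R s := cid (svalP (Q s)).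
  pose p2 s := sval (R s) : hom (p s) (G s).
  have pU s : is_product (p1 s) (p2 s) by exact: svalP (R s).
  have pE s w (u v : hom w (p s)) :
      p1 s ∘ u = p1 s ∘ v -> p2 s ∘ u = p2 s ∘ v -> u = v.
    move=> uv1 uv2; have [t [_ tU]] := pU s w (p1 s ∘ v) (p2 s ∘ v).
    by rewrite -(tU u) // -(tU v).
  pose r s t (st : (s <= t)%O) :=
    cid (pU t _ (res F st ∘ p1 s) (res G st ∘ p2 s)).
  have r1 s t (st : (s <= t)%O) : p1 t ∘ sval (r s t st) = res F st ∘ p1 s.
    by case: (r s t st) => u [[]].
  have r2 s t (st : (s <= t)%O) : p2 t ∘ sval (r s t st) = res G st ∘ p2 s.
    by case: (r s t st) => u [[]].
  have rid s (ss : (s <= s)%O) : sval (r s s ss) = idm (p s).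
    by apply: pE; rewrite ?r1 ?r2 res1 comp1m compm1.
  have rM s t u (st : (s <= t)%O) (tu : (t <= u)%O) (su : (s <= u)%O) :
      sval (r t u tu) ∘ sval (r s t st) = sval (r s u su).
    apply: pE; rewrite compA ?r1 ?r2 -compA ?r1 ?r2 compA.
      by rewrite (resM _ _ _ su).
    by rewrite (resM _ _ _ su).
  pose FG : sh := @Sheaf _ S V p (fun s t st => sval (r s t st)) rid rM.
  pose q1 : hom FG F := @SheafHom _ S V FG F p1 r1.
  pose q2 : hom FG G := @SheafHom _ S V FG G p2 r2.
  exists FG, q1, q2 => H a b.
  pose u s := cid (pU s _ (sh_map a s) (sh_map b s)).
  have u1 s : p1 s ∘ sval (u s) = sh_map a s by case: (u s) => v [[]].
  have u2 s : p2 s ∘ sval (u s) = sh_map b s by case: (u s) => v [[]].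
  have un s t (st : (s <= t)%O) :
      sval (u t) ∘ res H st = res FG st ∘ sval (u s).
    apply: pE; rewrite !compA ?u1 ?u2 /= ?r1 ?r2 -compA ?u1 ?u2; exact: sh_nat.
  exists (@SheafHom _ S V H FG (fun s => sval (u s)) un); split.
    by split; apply: sh_ext.
  move=> v [va vb]; apply: sh_ext => s; apply: pE.
    by rewrite [LHS]u1 -va.
  by rewrite [LHS]u2 -vb.
- by move=> F G a; exists (sh_ker a), (sh_ker_inc a); exact: sh_ker_incP.
- by move=> F G a; exists (sh_coker a), (sh_coker_proj a); exact: sh_coker_projP.
- move=> F G m mm; exists (sh_coker m), (sh_coker_proj m).
  apply: sh_kernelP => s; apply: (mono_is_kernel (ab_abelian V)).
    exact: sh_mono_stalk.
  exact: coker_projP.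
- move=> F G e ee; exists (sh_ker e), (sh_ker_inc e).
  apply: sh_cokernelP => s; apply: (epi_is_cokernel (ab_abelian V)).
    exact: sh_epi_stalk.
  exact: ker_incP.
Qed.

(* A sheaf [F] embeds in the product, over [s : S], of the direct images of
   injective objects containing [F s]; the stalk of that product at [t] is the
   product over the [s] above [t]. *)
Lemma sheaf_enough_injectives : enough_injectives sh.
Proof.
move=> F; pose J s := inj_ob (F s).
pose P t := cid (finite_product (ab_abelian V)
  (fun s : {s : S | (t <= s)%O} => J (sval s))).
pose E t := sval (P t); pose Q t := cid (svalP (P t)).
pose pi t (s : S) (ts : (t <= s)%O) : hom (E t) (J s) :=
  sval (Q t) (exist _ s ts).
have piU t w (c : forall s, (t <= s)%O -> hom w (J s)) :
    {u : hom w (E t) | forall s (ts : (t <= s)%O), pi t s ts ∘ u = c s ts}.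
  apply: cid; have [u [uc _]] := svalP (Q t) w (fun s => c (sval s) (proj2_sig s)).
  by exists u => s ts; exact: uc (exist _ s ts).
have piE t w (u v : hom w (E t)) :
    (forall s ts, pi t s ts ∘ u = pi t s ts ∘ v) -> u = v.
  move=> uv; have [x [_ xU]] := svalP (Q t) w (fun s => sval (Q t) s ∘ v).
  have <- : x = u by apply: xU => -[s ts]; exact: uv.
  exact: xU.
pose r t t' (tt : (t <= t')%O) :=
  piU t' (E t) (fun s t's => pi t s (le_trans tt t's)).
have rid t (tt : (t <= t)%O) : sval (r t t tt) = idm (E t).
  apply: piE => s ts; rewrite (svalP (r t t tt)) compm1.
  by congr (pi t s); exact: bool_irrelevance.
have rM t t' t'' (tt : (t <= t')%O) (tt' : (t' <= t'')%O) (tt'' : (t <= t'')%O) :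
    sval (r t' t'' tt') ∘ sval (r t t' tt) = sval (r t t'' tt'').
  apply: piE => s ts; rewrite compA (svalP (r _ _ tt')) (svalP (r _ _ tt)).
  by rewrite (svalP (r _ _ tt'')); congr (pi t s); exact: bool_irrelevance.
pose EF : sh := @Sheaf _ S V E (fun t t' tt => sval (r t t' tt)) rid rM.
pose m t := piU t (F t) (fun s ts => inj_emb (F s) ∘ res F ts).
have mn t t' (tt : (t <= t')%O) :
    sval (m t') ∘ res F tt = res EF tt ∘ sval (m t).
  apply: piE => s ts; rewrite !compA (svalP (m t')) (svalP (r t t' tt)).
  by rewrite (svalP (m t)) -compA (resM _ _ _ (le_trans tt ts)).
exists EF, (@SheafHom _ S V F EF (fun t => sval (m t)) mn); split; last first.
  move=> H a b ab; apply: sh_ext => s; apply: (inj_embP (F s)).2.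
  have /(congr1 (fun f => pi s s (lexx s) ∘ f)) :=
    congr1 (fun c : sheaf_hom H EF => c s) ab.
  by rewrite /= !compA (svalP (m s)) res1 compm1.
move=> X Y i im f.
have gP s : {g : hom (Y s) (J s) |
    g ∘ sh_map i s = pi s s (lexx s) ∘ sh_map f s}.
  apply: cid; apply: (inj_embP (F s)).1; exact: sh_mono_stalk.
pose g t := piU t (Y t) (fun s ts => sval (gP s) ∘ res Y ts).
have gn t t' (tt : (t <= t')%O) :
    sval (g t') ∘ res Y tt = res EF tt ∘ sval (g t).
  apply: piE => s ts; rewrite !compA (svalP (g t')) (svalP (r t t' tt)).
  by rewrite (svalP (g t)) -compA (resM _ _ _ (le_trans tt ts)).
exists (@SheafHom _ S V Y EF (fun t => sval (g t)) gn); apply: sh_ext => t.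
apply: piE => s ts; rewrite compA (svalP (g t)) -compA -sh_nat compA.
rewrite (svalP (gP s)) -compA.
apply: etrans (congr1 (fun v => pi s s (lexx s) ∘ v) (sh_nat f ts)) _.
rewrite compA (svalP (r t s ts)).
by congr (pi t s _ ∘ _); exact: bool_irrelevance.
Qed.

Definition sheaf_cat : abcat := Abcat sheaf_abelian sheaf_enough_injectives.

End SheafAbelian.

Arguments sheaf_cat {disp} S V.

Section GlobalSections.
Context {disp : Order.disp_t}.
Variables (S : finPOrderType disp) (V : abcat).
Implicit Types F G H : sheaf_cat S V.

Definition compatible F w (c : forall s, hom w (stalk F s)) : Prop :=
  forall s t (st : (s <= t)%O), res F st ∘ c s = c t.

Definition is_limit F l (pi : forall s, hom l (stalk F s)) : Prop :=
  compatible pi /\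
  forall w (c : forall s, hom w (stalk F s)), compatible c ->
    exists! u : hom w l, forall s, pi s ∘ u = c s.

Lemma limit_ex F : exists l (pi : forall s, hom l (stalk F s)), is_limit pi.
Proof.
have [p [pi piU]] := finite_product (ab_abelian V) (stalk F).
have [q [rho rhoU]] :=
  finite_product (ab_abelian V) (fun st : S * S => stalk F st.2).
pose D (st : S * S) : hom p (F st.2) :=
  if pselect (st.1 <= st.2)%O is left h then res F h ∘ pi st.1 - pi st.2
  else 0.
have DE s t (st : (s <= t)%O) : D (s, t) = res F st ∘ pi s - pi t.
  by rewrite /D /=; case: pselect => // h; rewrite (bool_irrelevance h st).
have D0 s t : ~~ (s <= t)%O -> D (s, t) = 0.
  by move=> /negP st; rewrite /D /=; case: pselect.
have [d [dD _]] := rhoU p D.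
exists (ker_ob d), (fun s => pi s ∘ ker_inc d); split.
  move=> s t st; apply/eqP; rewrite -subr_eq0 compA -compBl -DE -dD.
  by rewrite -compA (ker_incP d).1 compm0.
move=> w c cc; have [u [uc uU]] := piU w c.
have du0 : d ∘ u = 0.
  have [v [_ vU]] := rhoU w (fun=> 0).
  have <- : v = 0 by apply: vU => st; exact: compm0.
  apply/esym/vU => -[s t].
  rewrite compA dD; have [st|st] := boolP (s <= t)%O; last first.
    by rewrite D0 // comp0m.
  by rewrite DE compBl -compA !uc cc subrr.
exists (ker_lift du0); split=> [s|v vc]; first by rewrite -compA ker_liftK.
apply: (is_kernel_mono (ker_incP d)); rewrite ker_liftK.
by apply: uU => s; rewrite compA.
Qed.

Definition gsec_ob F : V := sval (cid (limit_ex F)).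

Definition gsec_proj F : forall s, hom (gsec_ob F) (stalk F s) :=
  sval (cid (svalP (cid (limit_ex F)))).

Lemma gsecP F : is_limit (gsec_proj F).
Proof. exact: svalP (cid (svalP (cid (limit_ex F)))). Qed.

Definition gsec_lift F w (c : forall s, hom w (stalk F s)) (cc : compatible c) :
    hom w (gsec_ob F) :=
  sval (cid ((gsecP F).2 w c cc)).

Lemma gsec_liftK F w (c : forall s, hom w (stalk F s)) (cc : compatible c) s :
  gsec_proj F s ∘ gsec_lift cc = c s.
Proof. by rewrite /gsec_lift; case: cid => u []. Qed.

Lemma gsec_ext F w (u v : hom w (gsec_ob F)) :
  (forall s, gsec_proj F s ∘ u = gsec_proj F s ∘ v) -> u = v.
Proof.
move=> uv; have vc : compatible (fun s => gsec_proj F s ∘ v).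
  by move=> s t st; rewrite compA (gsecP F).1.
by have [x [_ xU]] := (gsecP F).2 w _ vc; rewrite -(xU u) // -(xU v).
Qed.

Lemma gsec_map_subproof F G (a : hom F G) :
  compatible (fun s => sh_map a s ∘ gsec_proj F s).
Proof.
by move=> s t st; rewrite compA -sh_nat -compA (gsecP F).1.
Qed.

Definition gsec_map F G (a : hom F G) : hom (gsec_ob F) (gsec_ob G) :=
  gsec_lift (gsec_map_subproof a).

Definition gsec : additive_functor (sheaf_cat S V) V.
Proof.
refine (@AdditiveFunctor (sheaf_cat S V) V gsec_ob gsec_map _ _ _).
- by move=> F; apply: gsec_ext => s; rewrite gsec_liftK comp1m compm1.
- move=> F G H b a; apply: gsec_ext => s.
  by rewrite compA !gsec_liftK -[RHS]compA gsec_liftK compA.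
- move=> F G a b; apply: gsec_ext => s.
  by rewrite compDr !gsec_liftK compDl.
Defined.

Definition sheaf_coh (j : nat) F : V := rderived gsec j F.

End GlobalSections.

Definition subposet {disp : Order.disp_t} {S : finPOrderType disp}
  (T : {set S}) : Type := {s : S | s \in T}.

HB.instance Definition _ {disp : Order.disp_t} {S : finPOrderType disp}
  (T : {set S}) := SubFinite.on (subposet T).
HB.instance Definition _ {disp : Order.disp_t} {S : finPOrderType disp}
  (T : {set S}) := [SubChoice_isSubPOrder of subposet T by <: with disp].

Section Restriction.
Context {disp : Order.disp_t} {S : finPOrderType disp} {V : abcat}.
Variable T : {set S}.
Implicit Types F G H : sheaf_cat S V.

Definition restrict_ob F : sheaf_cat (subposet T) V :=
  @Sheaf _ (subposet T) V (fun s => stalk F (val s))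
    (fun s t st => @res _ _ _ F (val s) (val t) st)
    (fun s ss => res1 F ss) (fun s t u st tu su => resM F st tu su).

Definition restrict_map F G (a : hom F G) :
    hom (restrict_ob F) (restrict_ob G) :=
  @SheafHom _ (subposet T) V (restrict_ob F) (restrict_ob G)
    (fun s => sh_map a (val s)) (fun s t st => sh_nat a st).

Definition restrict : additive_functor (sheaf_cat S V) (sheaf_cat (subposet T) V).
Proof.
by refine (@AdditiveFunctor (sheaf_cat S V) (sheaf_cat (subposet T) V)
  restrict_ob restrict_map _ _ _) => *; apply: sh_ext.
Defined.

Lemma restrict_short_exact F G H (a : hom F G) (b : hom G H) :
  short_exact a b -> short_exact (fmap restrict a) (fmap restrict b).
Proof.
move=> [aK bK]; split.
  by apply: sh_kernelP => s; exact: sh_kernel_stalk aK.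
by apply: sh_cokernelP => s; exact: sh_cokernel_stalk bK.
Qed.

Lemma gsec_restrict_subproof F :
  @compatible _ _ _ (restrict F) (gsec S V F) (fun s => gsec_proj F (val s)).
Proof. by move=> s t st; exact: (gsecP F).1. Qed.

Definition gsec_restrict F :
    hom (gsec S V F) (gsec (subposet T) V (restrict F)) :=
  gsec_lift (gsec_restrict_subproof F).

(* [th] is a morphism of delta-functors, from the cohomology of [S] to the
   cohomology on [T] of the restrictions to [T], which in degree zero extends
   the restriction of global sections; the latter are identified with the
   zeroth cohomology by [rderived_unit]. *)
Definition delta_extension (th : forall (j : nat) F,
    hom (sheaf_coh j F) (sheaf_coh j (restrict F))) : Prop :=
  [/\ forall F,
        th 0%N F ∘ rderived_unit (gsec S V) F =
        rderived_unit (gsec (subposet T) V) (restrict F) ∘ gsec_restrict F,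
      forall j F G (a : hom F G),
        th j G ∘ rderived_map (gsec S V) j a =
        rderived_map (gsec (subposet T) V) j (fmap restrict a) ∘ th j F
    & forall j F G H (a : hom F G) (b : hom G H) (ab : short_exact a b),
        th j.+1 F ∘ connecting (gsec S V) j ab =
        connecting (gsec (subposet T) V) j (restrict_short_exact ab) ∘ th j H].

End Restriction.

Section Beat.
Context {disp : Order.disp_t} {V : abcat}.

Definition downbeat (S : finPOrderType disp) (s : S) : Prop :=
  exists a : S, (a < s)%O /\ forall b : S, (b < s)%O -> (b <= a)%O.

Definition upbeat (S : finPOrderType disp) (F : sheaf_cat S V) (s : S) : Prop :=
  exists a (sa : (s < a)%O),
    (forall b : S, (s < b)%O -> (a <= b)%O) /\ is_iso (res F (ltW sa)).

Definition beat (S : finPOrderType disp) (F : sheaf_cat S V) (s : S) : Prop :=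
  upbeat F s \/ downbeat s.

Definition is_core (S : finPOrderType disp) (F : sheaf_cat S V) : Prop :=
  forall s, ~ beat F s.

(* As restriction is transitive, every sheaved space obtained from [(S, F)] by
   deletions is determined by its underlying subset [R] of [S]. *)
Inductive deletes_to (S : finPOrderType disp) (F : sheaf_cat S V) :
    {set S} -> Prop :=
| deletes_to_self : deletes_to F [set: S]
| deletes_to_step (R : {set S}) (v : subposet R) :
    deletes_to F R -> beat (restrict R F) v -> deletes_to F (R :\ val v).

Definition core_of (S : finPOrderType disp) (F : sheaf_cat S V) (T : {set S}) :
    Prop :=
  deletes_to F T /\ is_core (restrict T F).

End Beat.

(* Main.v *)
(* Write [i^*] for the restriction along a monotone map [i].  If [l] is left
   adjoint to [u] as maps of posets, then [u^*] is an exact left adjoint of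
   [l^*]; hence [l^*] is exact, preserves injectives and preserves global
   sections, so that it preserves cohomology.  A beat point [v] with witness [a]
   provides a retraction [r] of [R] onto [R \ v], sending [v] to [a].  For a
   downbeat, the inclusion [i] is left adjoint to [r], and [i^*] preserves the
   cohomology of every sheaf.  For an upbeat, [r] is left adjoint to [i], and
   [F] is isomorphic to [r^* i^* F], so that [F] and [i^* F] have the same
   cohomology.
   The maps on cohomology come from a comparison between the restriction of an
   injective resolution of [F] and an injective resolution of the restriction
   of [F]; they are the only extension to a delta-functor, because the
   connecting morphisms of [0 -> F -> I -> I/F -> 0] with [I] injective are
   epimorphisms. *)

From mathcomp Require Import all_boot all_order all_algebra.
From mathcomp Require Import boolp.
Require Import Defs.

Set Implicit Arguments.
Unset Strict Implicit.
Unset Printing Implicit Defensive.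

Import Order.TTheory GRing.Theory.
Local Open Scope ring_scope.

(** * Chain maps up to homotopy *)

Section Chains.
Variable A : abcat.
Implicit Types x y z w : A.
Implicit Types X Y Z K : complex A.

(** Exactness without injectivity of the terms, as holds for the image of an injective resolution
    under an exact functor. *)
Definition resolves x X (eps : hom x (X 0%N)) : Prop :=
  is_kernel (cx_d X 0) eps /\ forall n, exact (cx_d X n) (cx_d X n.+1).

Definition chain X Y (f : forall n, hom (X n) (Y n)) : Prop :=
  forall n, f n.+1 ∘ cx_d X n = cx_d Y n ∘ f n.

Lemma resolution_resolves x (I : injective_resolution x) :
  resolves (ir_aug I).
Proof. by split; [exact: ir_exact0|exact: ir_exact]. Qed.

(** Each map extends along the exact complex [X] because the terms of [K] are injective; those of
    [X] may be arbitrary. *)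
Lemma extend_chain x y X (eps : hom x (X 0%N)) K (eta : hom y (K 0%N))
    (f : hom x y) :
    resolves eps -> cx_d K 0 ∘ eta = 0 -> (forall n, injective_object (K n)) ->
  exists phi : forall n, hom (X n) (K n),
    phi 0%N ∘ eps = eta ∘ f /\ chain phi.
Proof.
move=> [epsK exX] deta0 Kinj.
pose lifts n (u : hom (X n) (K n)) :=
  exists v : hom (X n.+1) (K n.+1), v ∘ cx_d X n = cx_d K n ∘ u.
have next n (u : hom (X n) (K n)) (v : hom (X n.+1) (K n.+1)) :
    v ∘ cx_d X n = cx_d K n ∘ u -> lifts n.+1 v.
  move=> vE; apply: (exact_extend (ab_abelian A) (Kinj n.+2) (exX n)).
  by rewrite -compA vE compA cx_dd comp0m.
have [phi0 phi0E] := cid (Kinj 0%N _ _ _ (is_kernel_mono epsK) (eta ∘ f)).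
have phi0L : lifts 0%N phi0.
  apply: (exact_extend (ab_abelian A) (Kinj 1%N) (kernel_exact epsK)).
  by rewrite -compA phi0E compA deta0 comp0m.
(* Each component carries the existence of the next one, which the recursion then chooses; the chain
   condition holds by construction. *)
pose T n := {u : hom (X n) (K n) | lifts n u}.
pose step n (u : T n) : T n.+1 :=
  exist _ (sval (cid (svalP u))) (next _ _ _ (svalP (cid (svalP u)))).
pose phi := nat_rect T (exist _ phi0 phi0L) step.
exists (fun n => sval (phi n)); split=> // n.
exact: svalP (cid (svalP (phi n))).
Qed.

(* [f] and [g] differ by boundary terms, so that they agree on cohomology; unlike
   for a chain homotopy, [b] and [c] are not related across degrees. *)
Definition cohomologous X Y j k (f g : hom (X j) (Y k)) : Prop :=
  exists (b : hom (X j) (Y k.-1)) (c : hom (X j.+1) (Y k)),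
    f = g + (cx_din Y k ∘ b + c ∘ cx_d X j).

Lemma cohomologousB X Y j k (f g : hom (X j) (Y k)) :
  cohomologous (f - g) 0 -> cohomologous f g.
Proof.
by move=> [b [c E]]; exists b, c; rewrite -[f](subrK g) E add0r addrC.
Qed.

Lemma cohomologous_compr X Y Z i j k (f g : hom (Y j) (Z k)) (p : hom (X i) (Y j))
    (p' : hom (X i.+1) (Y j.+1)) :
  cx_d Y j ∘ p = p' ∘ cx_d X i -> cohomologous f g ->
  cohomologous (f ∘ p) (g ∘ p).
Proof.
move=> pE [b [c ->]]; exists (b ∘ p), (c ∘ p').
by rewrite !compDl -!compA pE.
Qed.

(** The classical induction: with [f n - g n] written by means of [b] and [c], the map
    [f n.+1 - g n.+1 - cx_d K n ∘ c] vanishes on the image of [cx_d X n], so that it extends along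
    the next differential. *)
Lemma chain_cohomologous x X (eps : hom x (X 0%N)) K
    (f g : forall n, hom (X n) (K n)) :
    resolves eps -> (forall n, injective_object (K n)) ->
    chain f -> chain g -> f 0%N ∘ eps = g 0%N ∘ eps ->
  forall n, cohomologous (f n) (g n).
Proof.
move=> [epsK exX] Kinj fC gC fg0 n; apply: cohomologousB.
elim: n => [|n [b [c E]]].
  have [|c cE] := exact_extend (u := f 0%N - g 0%N) (ab_abelian A) (Kinj 0%N)
    (kernel_exact epsK); first by rewrite compBl fg0 subrr.
  by exists 0, c; rewrite compm0 !add0r.
have [|c' c'E] := exact_extend (u := f n.+1 - g n.+1 - cx_d K n ∘ c)
    (ab_abelian A) (Kinj n.+1) (exX n); last first.
  by exists c, c'; rewrite c'E add0r [RHS]addrC subrK.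
rewrite !compBl fC gC -compBr E add0r compDr !compA cx_d_din comp0m add0r.
by rewrite subrr.
Qed.

(** Here [u] is a chain map into the shift of [K], whose differential is [- cx_d K]. An extension of
    [w] to [X 0] starts the homotopy, and the sign makes [c] reappear as [- c] one degree higher. *)
Lemma shift_cohomologous x X (eps : hom x (X 0%N)) K
    (u : forall n, hom (X n) (K n.+1)) (w : hom x (K 0%N)) :
    resolves eps -> (forall n, injective_object (K n)) ->
    (forall n, cx_d K n.+1 ∘ u n + u n.+1 ∘ cx_d X n = 0) ->
    u 0%N ∘ eps = cx_d K 0 ∘ w ->
  forall n, cohomologous (u n) 0.
Proof.
move=> [epsK exX] Kinj uC u0; elim=> [|n [b [c E]]].
  have [w' w'E] := Kinj 0%N _ _ _ (is_kernel_mono epsK) w.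
  have [|c cE] := exact_extend (u := u 0%N - cx_d K 0 ∘ w') (ab_abelian A)
    (Kinj 1%N) (kernel_exact epsK).
    by rewrite compBl u0 -compA w'E subrr.
  by exists w', c; rewrite cE add0r [RHS]addrC subrK.
have [|c' c'E] := exact_extend (u := u n.+1 + cx_d K n.+1 ∘ c)
    (ab_abelian A) (Kinj n.+2) (exX n); last first.
  by exists (- c), c'; rewrite c'E add0r compmN [RHS]addrC addrK.
rewrite compDl -compA -[c ∘ _](addKr (cx_d K n ∘ b)).
move: E; rewrite add0r /= => <-; rewrite compDr compmN compA cx_dd comp0m.
by rewrite oppr0 add0r addrC uC.
Qed.

Lemma coh_induced_comp X Y Z i j k (f : hom (X i) (Y j)) (f' : hom (Y j) (Z k))
    h h' :
  coh_induced f h -> coh_induced f' h' -> coh_induced (f' ∘ f) (h' ∘ h).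
Proof.
move=> [g [gE hE]] [g' [gE' hE']]; exists (g' ∘ g); split.
  by rewrite compA gE' -!compA gE.
by rewrite -compA hE compA hE' compA.
Qed.

Lemma coh_induced_id X j : coh_induced (idm (X j)) (idm (coh_ob X j)).
Proof. by exists (idm _); rewrite !compm1 !comp1m. Qed.

(** On cocycles [c ∘ cx_d X j] vanishes, and [cx_din Y k ∘ b] has values in the boundaries, which
    [coh_proj] kills. *)
Lemma coh_induced_cohomologous X Y j k (f f' : hom (X j) (Y k)) h :
  cohomologous f f' -> coh_induced f h -> coh_induced f' h.
Proof.
move=> [b [c E]] [g [gE hE]].
have f'E : ker_inc (cx_d Y k) ∘ g =
    f' ∘ ker_inc (cx_d X j) + cx_din Y k ∘ (b ∘ ker_inc (cx_d X j)).
  by rewrite gE E !compDl -!compA (ker_incP _).1 compm0 addr0.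
have f'0 : cx_d Y k ∘ (f' ∘ ker_inc (cx_d X j)) = 0.
  have := congr1 (comp (cx_d Y k)) f'E; rewrite compDr !compA cx_d_din !comp0m.
  by rewrite (ker_incP _).1 comp0m addr0.
exists (ker_lift f'0); split; first exact: ker_liftK.
have gg' : g = ker_lift f'0 + ker_lift (cx_d_din Y k) ∘ (b ∘ ker_inc (cx_d X j)).
  apply: (is_kernel_mono (ker_incP _)).
  by rewrite f'E compDr !compA !ker_liftK.
by rewrite hE gg' compDr compA (coker_projP _).1 comp0m addr0.
Qed.

Definition quasi_iso X Y (f : forall n, hom (X n) (Y n)) : Prop :=
  forall j, exists h : hom (coh_ob X j) (coh_ob Y j),
    coh_induced (f j) h /\ is_iso h.

Lemma chain_induced X Y (f : forall n, hom (X n) (Y n)) j :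
  chain f -> exists h : hom (coh_ob X j) (coh_ob Y j), coh_induced (f j) h.
Proof.
move=> fC; apply: (coh_induced_ex (f' := f j.+1) (b := f j.-1)) => //.
by case: j => [|j]; rewrite ?comp0m ?compm0 //=; exact: fC.
Qed.

Lemma is_iso_comp x y z (f : hom x y) (g : hom y z) :
  is_iso f -> is_iso g -> is_iso (g ∘ f).
Proof.
move=> [f' [f'f ff']] [g' [g'g gg']]; exists (f' ∘ g'); split.
  by rewrite -compA [g' ∘ _]compA g'g comp1m.
by rewrite -compA [f ∘ _]compA ff' comp1m.
Qed.

Lemma quasi_iso_comp X Y Z (f : forall n, hom (X n) (Y n))
    (g : forall n, hom (Y n) (Z n)) :
  quasi_iso f -> quasi_iso g -> quasi_iso (fun n => g n ∘ f n).
Proof.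
move=> fQ gQ j; have [h [hE hI]] := fQ j; have [k [kE kI]] := gQ j.
by exists (k ∘ h); split; [exact: coh_induced_comp|exact: is_iso_comp].
Qed.

Lemma quasi_iso_cancel X Y Z (f : forall n, hom (X n) (Y n))
    (g : forall n, hom (Y n) (Z n)) :
  chain f -> quasi_iso g -> quasi_iso (fun n => g n ∘ f n) -> quasi_iso f.
Proof.
move=> fC gQ gfQ j; have [h hE] := chain_induced j fC; exists h; split=> //.
have [k [kE [k' [k'k kk']]]] := gQ j; have [l [lE lI]] := gfQ j.
have -> : h = k' ∘ l.
  by rewrite (coh_induced_uniq lE (coh_induced_comp hE kE)) compA k'k comp1m.
by apply: is_iso_comp => //; exists k.
Qed.

Lemma quasi_iso_cohomologous X Y (f g : forall n, hom (X n) (Y n)) :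
  (forall n, cohomologous (f n) (g n)) -> quasi_iso f -> quasi_iso g.
Proof.
move=> fg fQ j; have [h [hE hI]] := fQ j; exists h; split=> //.
exact: coh_induced_cohomologous (fg j) hE.
Qed.

Lemma quasi_isoI X Y (f : forall n, hom (X n) (Y n))
    (g : forall n, hom (Y n) (X n)) :
    chain f -> chain g -> (forall n, cohomologous (g n ∘ f n) (idm _)) ->
    (forall n, cohomologous (f n ∘ g n) (idm _)) ->
  quasi_iso f.
Proof.
move=> fC gC gf fg j; have [h hE] := chain_induced j fC.
have [k kE] := chain_induced j gC; exists h; split=> //; exists k; split.
  apply: (coh_induced_uniq _ (coh_induced_id X j)).
  exact: coh_induced_cohomologous (gf j) (coh_induced_comp hE kE).
apply: (coh_induced_uniq _ (coh_induced_id Y j)).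
exact: coh_induced_cohomologous (fg j) (coh_induced_comp kE hE).
Qed.

Lemma cohomologous_refl X Y j k (f : hom (X j) (Y k)) : cohomologous f f.
Proof. by exists 0, 0; rewrite compm0 comp0m !addr0. Qed.

Lemma iso_quasi_iso X Y (f : forall n, hom (X n) (Y n)) :
  chain f -> (forall n, is_iso (f n)) -> quasi_iso f.
Proof.
move=> fC fI; pose g n := sval (cid (fI n)).
have gf n : g n ∘ f n = idm _ by exact: (svalP (cid (fI n))).1.
have fg n : f n ∘ g n = idm _ by exact: (svalP (cid (fI n))).2.
apply: (quasi_isoI (g := g)) => // n.
- rewrite -[RHS]comp1m -(gf n.+1) -compA [_ ∘ (cx_d X n ∘ _)]compA fC.
  by rewrite -[_ ∘ g n]compA fg compm1.
- by rewrite gf; exact: cohomologous_refl.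
- by rewrite fg; exact: cohomologous_refl.
Qed.

End Chains.

(** * Chain maps under an additive functor *)

Section Functor.
Variables (A B : abcat) (G : additive_functor A B).
Implicit Types X Y : complex A.

Lemma fmap_chain X Y (f : forall n, hom (X n) (Y n)) :
  chain f -> @chain B (fmap_cx G X) (fmap_cx G Y) (fun n => fmap G (f n)).
Proof. by move=> fC n; rewrite /= -!fmapM fC. Qed.

Lemma fmap_cohomologous X Y j k (f g : hom (X j) (Y k)) :
  cohomologous f g ->
  @cohomologous B (fmap_cx G X) (fmap_cx G Y) j k (fmap G f) (fmap G g).
Proof.
move=> [b [c ->]]; exists (fmap G b), (fmap G c).
rewrite !fmapD !fmapM; congr (_ + (_ ∘ _ + _)).
(* For [k = 0] the incoming differential is zero by convention, on both sides. *)
by case: k {f g c} b => //= b; rewrite fmap0.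
Qed.

(** A lift [psi] of the inverse of [f] inverts [phi] up to boundary terms, since chain maps between
    injective resolutions are determined up to these by their effect on the augmentations. *)
Lemma resolution_quasi_iso x y (I : injective_resolution x)
    (J : injective_resolution y) (f : hom x y) (phi : forall n, hom (I n) (J n)) :
    is_iso f -> phi 0%N ∘ ir_aug I = ir_aug J ∘ f -> chain phi ->
  @quasi_iso B (fmap_cx G I) (fmap_cx G J) (fun n => fmap G (phi n)).
Proof.
move=> [g [gf fg]] phi0 phiC.
have [psi [psi0 psiC]] := extend_chain g (resolution_resolves J)
  (ir_exact0 I).1 (@ir_injective _ _ I).
apply: (@quasi_isoI B (fmap_cx G I) (fmap_cx G J) _
  (fun n => fmap G (psi n))); [exact: fmap_chain..| |].
  move=> n; rewrite /= -fmapM -fmap1; apply: fmap_cohomologous.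
  apply: (chain_cohomologous (f := fun n => psi n ∘ phi n)
    (g := fun n => idm (I n)) (resolution_resolves I)) => [|m|m|].
  - exact: ir_injective.
  - by rewrite -compA phiC !compA psiC.
  - by rewrite comp1m compm1.
  - by rewrite -compA phi0 compA psi0 -compA gf compm1 comp1m.
move=> n; rewrite /= -fmapM -fmap1; apply: fmap_cohomologous.
apply: (chain_cohomologous (f := fun n => phi n ∘ psi n)
  (g := fun n => idm (J n)) (resolution_resolves J)) => [|m|m|].
- exact: ir_injective.
- by rewrite -compA psiC !compA phiC.
- by rewrite comp1m compm1.
- by rewrite -compA psi0 compA phi0 -compA fg compm1 comp1m.
Qed.

End Functor.

(** * Comparison along an exact functor *)

Section Restriction.
Variables (A A' B : abcat) (R : additive_functor A A').
Variables (G : additive_functor A B) (G' : additive_functor A' B).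
Variable rho : forall x, hom (G x) (G' (R x)).

(* Quantifying over all resolutions and comparisons makes this property stable
   under composition of restrictions. *)
Definition preserves_coh (x : A) : Prop :=
  forall (I : injective_resolution x) (J : injective_resolution (R x))
    (phi : forall n, hom (R (I n)) (J n)),
  phi 0%N ∘ fmap R (ir_aug I) = ir_aug J -> @chain A' (fmap_cx R I) J phi ->
  @quasi_iso B (fmap_cx G I) (fmap_cx G' J)
    (fun n => fmap G' (phi n) ∘ rho (I n)).

Hypothesis rho_nat : forall x y (f : hom x y),
  rho y ∘ fmap G f = fmap G' (fmap R f) ∘ rho x.
Hypothesis R_kernel : forall x y k (f : hom x y) (i : hom k x),
  is_kernel f i -> is_kernel (fmap R f) (fmap R i).
Hypothesis R_epi : forall x y (f : hom x y), epi f -> epi (fmap R f).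

(** [exact] speaks of a kernel and an epimorphism only, and [R] preserves both. *)
Lemma fmap_resolves x (X : complex A) (eps : hom x (X 0%N)) :
  resolves eps -> @resolves A' (R x) (fmap_cx R X) (fmap R eps).
Proof.
move=> [epsK exX]; split=> [|n]; first exact: R_kernel.
have [k [i [e [iK ee ie]]]] := exX n.
exists (R k), (fmap R i), (fmap R e).
by split; [exact: R_kernel|exact: R_epi|rewrite -fmapM ie].
Qed.

Lemma restriction_chain (X : complex A) (Y : complex A')
    (f : forall n, hom (R (X n)) (Y n)) :
  @chain A' (fmap_cx R X) Y f ->
  @chain B (fmap_cx G X) (fmap_cx G' Y) (fun n => fmap G' (f n) ∘ rho (X n)).
Proof.
by move=> fC n; rewrite /= -compA rho_nat !compA -!fmapM fC.
Qed.

Lemma restriction_cohomologous (X : complex A) (Y : complex A') j k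
    (f g : hom (R (X j)) (Y k)) :
  @cohomologous A' (fmap_cx R X) Y j k f g ->
  @cohomologous B (fmap_cx G X) (fmap_cx G' Y) j k
    (fmap G' f ∘ rho (X j)) (fmap G' g ∘ rho (X j)).
Proof.
move=> fg; apply: (@cohomologous_compr B (fmap_cx G X)
  (fmap_cx G' (fmap_cx R X)) (fmap_cx G' Y) j j k (fmap G' f) (fmap G' g)
  (rho (X j)) (rho (X j.+1))); first by rewrite /= rho_nat.
exact: fmap_cohomologous.
Qed.

(** The map on cohomology induced by [rho] followed by [fmap G'] of a lift of the identity of
    [R x]. *)
Definition is_comparison j (x : A)
    (h : hom (rderived G j x) (rderived G' j (R x))) : Prop :=
  exists phi : forall n, hom (R (resolution x n)) (resolution (R x) n),
  [/\ phi 0%N ∘ fmap R (ir_aug (resolution x)) = ir_aug (resolution (R x)),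
      @chain A' (fmap_cx R (resolution x)) (resolution (R x)) phi
    & @coh_induced B (fmap_cx G (resolution x)) (fmap_cx G' (resolution (R x)))
        j j (fmap G' (phi j) ∘ rho (resolution x j)) h].

Lemma comparison_ex j x : exists h, @is_comparison j x h.
Proof.
have [phi [phi0 phiC]] := extend_chain (idm (R x))
  (fmap_resolves (resolution_resolves (resolution x)))
  (ir_exact0 (resolution (R x))).1 (@ir_injective _ _ (resolution (R x))).
have [h hE] := chain_induced j (restriction_chain phiC).
by exists h, phi; split=> //; rewrite phi0 compm1.
Qed.

Definition comparison_map j x : hom (rderived G j x) (rderived G' j (R x)) :=
  sval (cid (comparison_ex j x)).

Lemma comparison_mapP j x : is_comparison (comparison_map j x).
Proof. exact: svalP (cid (comparison_ex j x)). Qed.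

Lemma comparison_unit x :
  comparison_map 0 x ∘ rderived_unit G x = rderived_unit G' (R x) ∘ rho x.
Proof.
have [phi [phi0 _ [g [gE hE]]]] := comparison_mapP 0 x.
rewrite /rderived_unit compA hE -!compA; congr (_ ∘ _).
apply: (is_kernel_mono (ker_incP _)).
rewrite compA gE -compA ker_liftK compA ker_liftK /= -compA rho_nat.
by rewrite compA -fmapM phi0.
Qed.

(** Both sides are induced by lifts of [fmap R f] from the image of the resolution of [x] to the
    resolution of [R y], and two such lifts are cohomologous. *)
Lemma comparison_natural j x y (f : hom x y) :
  comparison_map j y ∘ rderived_map G j f =
  rderived_map G' j (fmap R f) ∘ comparison_map j x.
Proof.
have [phi [phi0 phiC phiE]] := comparison_mapP j x.
have [psi [psi0 psiC psiE]] := comparison_mapP j y.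
have [a [a0 aC aE]] := svalP (cid (rderived_map_ex G j f)).
have [b [b0 bC bE]] := svalP (cid (rderived_map_ex G' j (fmap R f))).
apply: (coh_induced_uniq _ (coh_induced_comp phiE bE)).
apply: coh_induced_cohomologous (coh_induced_comp aE psiE).
rewrite -compA rho_nat !compA -!fmapM; apply: restriction_cohomologous.
apply: (@chain_cohomologous A' _ (fmap_cx R (resolution x)) _
  (resolution (R y)) (fun n => psi n ∘ fmap R (a n)) (fun n => b n ∘ phi n)
  (fmap_resolves (resolution_resolves _))) => [|n|n|].
- exact: ir_injective.
- by rewrite /= -compA -fmapM aC fmapM compA psiC compA.
- by rewrite -compA phiC compA bC compA.
- by rewrite -!compA phi0 b0 -fmapM a0 fmapM compA psi0.
Qed.

(** Compares the connecting data [(e, tau)] of a sequence with data [(e', tau')] of its image under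
    [R]. The difference of the two sides is a chain map into the shift of [I'], so that
    [shift_cohomologous] applies. *)
Lemma connecting_square x y z (f : hom x y) (g : hom y z)
    (I : injective_resolution x) (K : injective_resolution z)
    (I' : injective_resolution (R x)) (K' : injective_resolution (R z))
    (phi : forall n, hom (R (I n)) (I' n)) (psi : forall n, hom (R (K n)) (K' n))
    (e : hom y (I 0%N)) (tau : forall n, hom (K n) (I n.+1))
    (e' : hom (R y) (I' 0%N)) (tau' : forall n, hom (K' n) (I' n.+1)) :
    short_exact (fmap R f) (fmap R g) ->
    phi 0%N ∘ fmap R (ir_aug I) = ir_aug I' -> @chain A' (fmap_cx R I) I' phi ->
    psi 0%N ∘ fmap R (ir_aug K) = ir_aug K' -> @chain A' (fmap_cx R K) K' psi ->
    e ∘ f = ir_aug I -> cx_d I 0 ∘ e + tau 0%N ∘ (ir_aug K ∘ g) = 0 ->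
    (forall n, cx_d I n.+1 ∘ tau n + tau n.+1 ∘ cx_d K n = 0) ->
    e' ∘ fmap R f = ir_aug I' ->
    cx_d I' 0 ∘ e' + tau' 0%N ∘ (ir_aug K' ∘ fmap R g) = 0 ->
    (forall n, cx_d I' n.+1 ∘ tau' n + tau' n.+1 ∘ cx_d K' n = 0) ->
  forall n, @cohomologous A' (fmap_cx R K) I' n n.+1
    (phi n.+1 ∘ fmap R (tau n)) (tau' n ∘ psi n).
Proof.
move=> Rfg phi0 phiC psi0 psiC ef e0 eS ef' e0' eS' n; apply: cohomologousB.
(* Both [e'] and [phi 0 ∘ fmap R e] extend [ir_aug I'] along [fmap R f]; the factor [w] of their
   difference through [fmap R g] starts the homotopy. *)
have [|w [wE _]] := Rfg.2.2 _ (e' - phi 0%N ∘ fmap R e).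
  by rewrite compBl ef' -compA -fmapM ef phi0 subrr.
apply: (@shift_cohomologous A' _ (fmap_cx R K) _
  I' (fun n => phi n.+1 ∘ fmap R (tau n) - tau' n ∘ psi n) w
  (fmap_resolves (resolution_resolves _))) => {n} [n|n|].
- exact: ir_injective.
- have Rd : cx_d (fmap_cx R K) n = fmap R (cx_d K n) by [].
  rewrite compBr compBl compA -phiC -!compA psiC Rd -!fmapM addrACA -compDr.
  rewrite -fmapD eS fmap0 compm0 add0r -opprD !compA -compDl eS' comp0m.
  exact: oppr0.
apply: (is_cokernel_epi Rfg.2); rewrite -[RHS]compA wE compBr.
rewrite compBl -[tau' _ ∘ _ ∘ _]compA psi0 compBl -!compA -!fmapM.
have /eqP := e0; rewrite addrC addr_eq0 => /eqP->.
have /eqP := e0'; rewrite addrC addr_eq0 => /eqP->.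
by rewrite fmapN fmapM compmN compA phiC opprK addrC -compA.
Qed.

Lemma comparison_connecting j x y z (f : hom x y) (g : hom y z)
    (fg : short_exact f g) (Rfg : short_exact (fmap R f) (fmap R g)) :
  comparison_map j.+1 x ∘ connecting G j fg =
  connecting G' j Rfg ∘ comparison_map j z.
Proof.
have [phi [phi0 phiC phiE]] := comparison_mapP j.+1 x.
have [psi [psi0 psiC psiE]] := comparison_mapP j z.
have [e [tau [ef e0 eS tauE]]] := svalP (cid (connecting_ex G j fg)).
have [e' [tau' [ef' e0' eS' tauE']]] := svalP (cid (connecting_ex G' j Rfg)).
apply: (coh_induced_uniq _ (coh_induced_comp psiE tauE')).
apply: coh_induced_cohomologous (coh_induced_comp tauE phiE).
rewrite -compA rho_nat !compA -!fmapM; apply: restriction_cohomologous.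
exact: (connecting_square Rfg phi0 phiC psi0 psiC ef e0 eS ef' e0' eS').
Qed.

Lemma comparison_iso x : preserves_coh x -> forall j, is_iso (comparison_map j x).
Proof.
move=> xG j; have [phi [phi0 phiC phiE]] := comparison_mapP j x.
have [h [hE hI]] := xG _ _ phi phi0 phiC j.
by rewrite (coh_induced_uniq phiE hE).
Qed.

End Restriction.

(** * Uniqueness of the extension to a delta-functor *)

Section Shift.
Variable A : abcat.

(** The factorizations [v ∘ p] and [m ∘ c] of [f] are related by [t] with [m ∘ t = v]. It is a
    monomorphism because [v] is, and an epimorphism because [c] is, hence invertible. *)
Lemma exact_coimage (u x y z q : A) (i : hom u x) (f : hom x y) (g : hom y z)
    (p : hom x q) (v : hom q y) :
  is_kernel f i -> is_cokernel i p -> v ∘ p = f -> exact f g -> is_kernel g v.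
Proof.
move=> iK pK vp [k [m [c [mK cE mc]]]].
have gv0 : g ∘ v = 0.
  apply: (is_cokernel_epi pK); rewrite comp0m -compA vp -mc compA mK.1.
  exact: comp0m.
have vm := coimage_mono (ab_abelian A) iK pK vp.
have [t [tE _]] := mK.2 _ _ gv0.
have tp : t ∘ p = c by apply: (is_kernel_mono mK); rewrite compA tE vp mc.
have tm : mono t.
  by move=> w a b tab; apply: vm; rewrite -tE -!compA tab.
have [ct0 tU] := mono_is_kernel (ab_abelian A) tm (coker_projP t).
have r0 : coker_proj t = 0.
  by apply: cE; rewrite -tp compA ct0 !comp0m.
have [|s [sE _]] := tU _ (idm k); first by rewrite r0 comp0m.
apply: is_kernelI => // w h gh0; have [a [aE _]] := mK.2 _ _ gh0; exists (s ∘ a).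
by rewrite -tE -compA [t ∘ _]compA sE comp1m.
Qed.

Lemma exactN (x y z : A) (f : hom x y) (g : hom y z) :
  exact f g -> exact (- f) (- g).
Proof.
move=> [k [i [e [[gi0 iU] ee <-]]]]; exists k, i, (- e); split.
- split=> [|w h]; first by rewrite compNm gi0 oppr0.
  by rewrite compNm => /eqP; rewrite oppr_eq0 => /eqP; exact: iU.
- by move=> w a b; rewrite !compmN => /oppr_inj /ee.
by rewrite compmN.
Qed.

Variables (x : A) (I : injective_resolution x).

Lemma shift_dd n : - cx_d I n.+2 ∘ - cx_d I n.+1 = 0.
Proof. by rewrite compNm compmN opprK cx_dd. Qed.

Definition shift_cx : complex A :=
  @Complex A (fun n => I n.+1) (fun n => - cx_d I n.+1) shift_dd.

(** Dimension shifting: by [exact_coimage], [v] is a kernel of [cx_d I 1], so that the tail of [I]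
    resolves the cokernel of the augmentation. *)
Lemma shift_resolves z (g : hom (I 0%N) z) (v : hom z (I 1%N)) :
    is_cokernel (ir_aug I) g -> v ∘ g = cx_d I 0 ->
  @resolves A z shift_cx v.
Proof.
move=> gK vg; split=> [|n]; last exact: exactN (ir_exact I n.+1).
have [dv0 vU] := exact_coimage (ir_exact0 I) gK vg (ir_exact I 0%N).
split=> [|w h]; first by rewrite compNm dv0 oppr0.
by rewrite compNm => /eqP; rewrite oppr_eq0 => /eqP; exact: vU.
Qed.

(* When the middle term of the short exact sequence is injective, [tau] is, up
   to sign, the comparison of two injective resolutions of [z]. *)
Lemma connecting_section z (g : hom (I 0%N) z) (L : injective_resolution z)
    (e : hom (I 0%N) (I 0%N)) (tau : forall n, hom (L n) (I n.+1)) :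
    short_exact (ir_aug I) g -> e ∘ ir_aug I = ir_aug I ->
    cx_d I 0 ∘ e + tau 0%N ∘ (ir_aug L ∘ g) = 0 ->
    (forall n, cx_d I n.+1 ∘ tau n + tau n.+1 ∘ cx_d L n = 0) ->
  exists sigma : forall n, hom (shift_cx n) (L n), chain sigma /\
    forall n, @cohomologous A shift_cx I n n.+1 (tau n ∘ sigma n) (- idm _).
Proof.
move=> fg ef e0 eS; have [v [vg _]] := fg.2.2 _ _ (ir_exact0 I).1.
(* [e] and the identity agree after [ir_aug I], so their difference factors through [g]; the factor
   [m] starts the homotopy. *)
have [|m [me _]] := fg.2.2 _ (idm _ - e).
  by rewrite compBl ef comp1m subrr.
have vK := shift_resolves fg.2 vg.
have [sigma [sigma0 sigmaC]] := extend_chain (idm z) vK (ir_exact0 L).1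
  (@ir_injective _ _ L).
exists sigma; split=> // n; apply: cohomologousB.
apply: (@shift_cohomologous A _ shift_cx _ I
  (fun n => tau n ∘ sigma n - - idm _) m vK) => {n} [n|n|].
- exact: ir_injective.
- rewrite !opprK compDr compDl comp1m compm1 -compA sigmaC !compA addrACA.
  by rewrite -compDl eS comp0m add0r subrr.
apply: (is_cokernel_epi fg.2).
rewrite opprK compDl comp1m -[_ ∘ _ ∘ v]compA sigma0 compm1 compDl vg -!compA.
rewrite me compBr compm1.
by have /eqP := e0; rewrite addrC addr_eq0 => /eqP->; rewrite addrC.
Qed.

End Shift.

(** * Epimorphy of the unit and of connecting morphisms *)

Section Effaceable.
Variables (A B : abcat) (G : additive_functor A B).

(** As [G] preserves kernels, [G x] is the object of 0-cocycles up to isomorphism; what remains is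
    the epimorphism from cocycles to cohomology. *)
Lemma unit_epi x :
  (forall y z k (f : hom y z) (i : hom k y),
    is_kernel f i -> is_kernel (fmap G f) (fmap G i)) ->
  epi (rderived_unit G x).
Proof.
move=> G_kernel w g h gh.
have [s [sE _]] := (G_kernel _ _ _ _ _ (ir_exact0 (resolution x))).2 _
  (ker_inc (cx_d (fmap_cx G (resolution x)) 0%N)) (ker_incP _).1.
apply: (is_cokernel_epi (coker_projP _)).
have lift_s : @ker_lift B _ _ _ (cx_d (fmap_cx G (resolution x)) 0) _
    (fmap_aug G x) ∘ s = idm _.
  by apply: (is_kernel_mono (ker_incP _)); rewrite compA ker_liftK sE compm1.
have := congr1 (fun u => u ∘ s) gh; rewrite /rderived_unit.
by rewrite -!compA lift_s !compm1.
Qed.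

(** By [connecting_section], the connecting morphism composed with the map [s] induced by [sigma] is
    induced by [- idm], and the cocycles of [shift_cx] in degree [j] are those of the resolution in
    degree [j.+1]. *)
Lemma connecting_epi j x z (g : hom (resolution x 0%N) z)
    (fg : short_exact (ir_aug (resolution x)) g) :
  epi (connecting G j fg).
Proof.
have [e [tau [ef e0 eS tauE]]] := svalP (cid (connecting_ex G j fg)).
have [sigma [sigmaC ts]] := connecting_section fg ef e0 eS.
pose K := shift_cx (resolution x).
have [s sE] := @chain_induced B (fmap_cx G K) (fmap_cx G (resolution z))
   (fun n => fmap G (sigma n)) j (fmap_chain G sigmaC).
have := coh_induced_comp sE tauE; rewrite -fmapM.
move=> /(coh_induced_cohomologous (fmap_cohomologous G (ts j)))[r [rE hr]].
(* The opposite of the inclusion of cocycles gives a right inverse of [r], as [r] is induced by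
   [- idm]. *)
have d0 : cx_d (fmap_cx G K) j ∘
    - ker_inc (cx_d (fmap_cx G (resolution x)) j.+1) = 0.
  by rewrite /= fmapN compNm compmN opprK (ker_incP _).1.
have rK : r ∘ ker_lift d0 = idm _.
  apply: (is_kernel_mono (ker_incP _)); rewrite compA rE -compA ker_liftK.
  by rewrite fmapN fmap1 compNm compmN opprK comp1m compm1.
move=> w a b ab; apply: (is_cokernel_epi (coker_projP _)).
have : a ∘ (connecting G j fg ∘ s ∘ coh_proj (fmap_cx G K) j) =
       b ∘ (connecting G j fg ∘ s ∘ coh_proj (fmap_cx G K) j).
  by rewrite -compA !compA ab.
rewrite [_ ∘ coh_proj _ _]hr !compA => /(congr1 (fun u => u ∘ ker_lift d0)).
by rewrite -!compA rK !compm1.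
Qed.

End Effaceable.

Section Uniqueness.
Variables (A A' B : abcat) (R : additive_functor A A').
Variables (G : additive_functor A B) (G' : additive_functor A' B).
Variable rho : forall x, hom (G x) (G' (R x)).
Hypothesis R_short_exact : forall x y z (f : hom x y) (g : hom y z),
  short_exact f g -> short_exact (fmap R f) (fmap R g).
Hypothesis G_kernel : forall x y k (f : hom x y) (i : hom k x),
  is_kernel f i -> is_kernel (fmap G f) (fmap G i).

(** Dimension shifting along the embedding of [x] in [resolution x 0]; in each degree an epimorphism
    is cancelled. *)
Lemma delta_unique
    (th th' : forall j x, hom (rderived G j x) (rderived G' j (R x))) :
    (forall x, th 0%N x ∘ rderived_unit G x = rderived_unit G' (R x) ∘ rho x) ->
    (forall x, th' 0%N x ∘ rderived_unit G x = rderived_unit G' (R x) ∘ rho x) ->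
    (forall j x y z (f : hom x y) (g : hom y z) (fg : short_exact f g),
      th j.+1 x ∘ connecting G j fg =
      connecting G' j (R_short_exact fg) ∘ th j z) ->
    (forall j x y z (f : hom x y) (g : hom y z) (fg : short_exact f g),
      th' j.+1 x ∘ connecting G j fg =
      connecting G' j (R_short_exact fg) ∘ th' j z) ->
  forall j x, th j x = th' j x.
Proof.
move=> th0 th'0 thS th'S; elim=> [|j IHj] x.
  by apply: (unit_epi (x := x) G_kernel); rewrite th0 th'0.
have ses : short_exact (ir_aug (resolution x))
    (coker_proj (ir_aug (resolution x))).
  split; last exact: coker_projP.
  apply: (mono_is_kernel (ab_abelian A)); last exact: coker_projP.
  exact: is_kernel_mono (ir_exact0 _).
by apply: (connecting_epi (fg := ses)); rewrite thS th'S IHj.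
Qed.

End Uniqueness.

(** * Composition of two restrictions *)

Section Composition.
Variables (A1 A2 A3 B : abcat).
Variables (R1 : additive_functor A1 A2) (R2 : additive_functor A2 A3).
Variables (G1 : additive_functor A1 B) (G2 : additive_functor A2 B).
Variable G3 : additive_functor A3 B.
Variable rho1 : forall x, hom (G1 x) (G2 (R1 x)).
Variable rho2 : forall x, hom (G2 x) (G3 (R2 x)).
Hypothesis rho1_nat : forall x y (f : hom x y),
  rho1 y ∘ fmap G1 f = fmap G2 (fmap R1 f) ∘ rho1 x.
Hypothesis rho2_nat : forall x y (f : hom x y),
  rho2 y ∘ fmap G2 f = fmap G3 (fmap R2 f) ∘ rho2 x.
Hypothesis R1_kernel : forall x y k (f : hom x y) (i : hom k x),
  is_kernel f i -> is_kernel (fmap R1 f) (fmap R1 i).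
Hypothesis R1_epi : forall x y (f : hom x y), epi f -> epi (fmap R1 f).
Hypothesis R2_kernel : forall x y k (f : hom x y) (i : hom k x),
  is_kernel f i -> is_kernel (fmap R2 f) (fmap R2 i).
Hypothesis R2_epi : forall x y (f : hom x y), epi f -> epi (fmap R2 f).

Definition functor_comp : additive_functor A1 A3.
Proof.
refine (@AdditiveFunctor A1 A3 (fun x => R2 (R1 x))
  (fun x y f => fmap R2 (fmap R1 f)) _ _ _).
- by move=> x; rewrite !fmap1.
- by move=> x y z g f; rewrite !fmapM.
- by move=> x y f g; rewrite !fmapD.
Defined.

(** Through a resolution [K] of [R1 x], two comparisons compose to one from the image of [I] to [J];
    as a lift of the identity it is cohomologous to [phi]. *)
Lemma preserves_coh_comp x :
  preserves_coh rho1 x -> preserves_coh rho2 (R1 x) ->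
  @preserves_coh A1 A3 B functor_comp G1 G3
    (fun y => rho2 (R1 y) ∘ rho1 y) x.
Proof.
move=> P1 P2 I J phi phi0 phiC; pose K := resolution (R1 x).
have I1 := fmap_resolves R1_kernel R1_epi (resolution_resolves I).
have [a [a0 aC]] := extend_chain (idm _) I1 (ir_exact0 K).1
  (@ir_injective _ _ K).
have K2 := fmap_resolves R2_kernel R2_epi (resolution_resolves K).
have [b [b0 bC]] := extend_chain (idm _) K2 (ir_exact0 J).1
  (@ir_injective _ _ J).
rewrite compm1 in a0; rewrite compm1 in b0.
apply: quasi_iso_cohomologous (quasi_iso_comp (P1 I K a a0 aC) (P2 K J b b0 bC)).
have rho_nat y z (f : hom y z) : rho2 (R1 z) ∘ rho1 z ∘ fmap G1 f =
    fmap G3 (fmap functor_comp f) ∘ (rho2 (R1 y) ∘ rho1 y).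
  by rewrite -compA rho1_nat !compA rho2_nat.
move=> n; have -> : fmap G3 (b n) ∘ rho2 (K n) ∘ (fmap G2 (a n) ∘ rho1 (I n)) =
    fmap G3 (b n ∘ fmap R2 (a n)) ∘ (rho2 (R1 (I n)) ∘ rho1 (I n)).
  by rewrite fmapM -!compA; congr (_ ∘ _); rewrite !compA rho2_nat.
apply: (restriction_cohomologous (R := functor_comp) rho_nat).
apply: (@chain_cohomologous A3 _ (fmap_cx functor_comp I) _ J
  (fun n => b n ∘ fmap R2 (a n)) phi
  (fmap_resolves R2_kernel R2_epi I1)) => {n} [n|n||].
- exact: ir_injective.
- by rewrite /= -compA -fmapM aC fmapM compA bC compA.
- exact: phiC.
by rewrite -compA -fmapM a0 b0 phi0.
Qed.

End Composition.

(** * Exact functors that preserve injectives *)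

Section FunctorResolution.
Variables (A A' : abcat) (R : additive_functor A A').
Hypothesis R_kernel : forall x y k (f : hom x y) (i : hom k x),
  is_kernel f i -> is_kernel (fmap R f) (fmap R i).
Hypothesis R_epi : forall x y (f : hom x y), epi f -> epi (fmap R f).
Hypothesis R_injective : forall x, injective_object x -> injective_object (R x).

Definition fmap_resolution x (I : injective_resolution x) :
    injective_resolution (R x) :=
  let RI := fmap_resolves R_kernel R_epi (resolution_resolves I) in
  @InjectiveResolution A' (R x) (fmap_cx R I) (fmap R (ir_aug I))
    (fun n => R_injective (@ir_injective _ _ I n)) RI.1 RI.2.

End FunctorResolution.

(** * Sheaves and monotone maps *)

Section Stalks.
Context {disp : Order.disp_t}.
Variables (S : finPOrderType disp) (V : abcat).
Implicit Types F G : sheaf_cat S V.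

Lemma sh_monoP F G (a : hom F G) : (forall s, mono (sh_map a s)) -> mono a.
Proof.
move=> am H b c abc; apply: sh_ext => s; apply: am.
exact: (congr1 (fun d : sheaf_hom H G => d s) abc).
Qed.

Lemma sh_epiP F G (a : hom F G) : (forall s, epi (sh_map a s)) -> epi a.
Proof.
move=> ae H b c abc; apply: sh_ext => s; apply: ae.
exact: (congr1 (fun d : sheaf_hom F H => d s) abc).
Qed.

Lemma sh_isoP F G (a : hom F G) : (forall s, is_iso (sh_map a s)) -> is_iso a.
Proof.
move=> aI; pose b s := sval (cid (aI s)).
have ba s : b s ∘ sh_map a s = idm _ by exact: (svalP (cid (aI s))).1.
have ab s : sh_map a s ∘ b s = idm _ by exact: (svalP (cid (aI s))).2.
suff bn s t (st : (s <= t)%O) : b t ∘ res G st = res F st ∘ b s.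
  exists (SheafHom bn : sheaf_hom G F).
  by split; apply: sh_ext => s; [exact: ba|exact: ab].
rewrite -[RHS]comp1m -(ba t) -compA [_ ∘ (res F st ∘ _)]compA sh_nat.
by rewrite -[_ ∘ b s]compA ab compm1.
Qed.

(** The inequalities force [s = t]; restricting along [ts] gives the inverse without transport along
    this equality. *)
Lemma res_iso F s t (st : (s <= t)%O) : (t <= s)%O -> is_iso (res F st).
Proof.
move=> ts; exists (res F ts).
by split; rewrite (resM _ _ _ (lexx _)) res1.
Qed.

Lemma gsec_kernel F G K (a : hom F G) (i : hom K F) :
  is_kernel a i -> is_kernel (fmap (gsec S V) a) (fmap (gsec S V) i).
Proof.
move=> iK; have iKs s := sh_kernel_stalk s iK.
apply: is_kernelI.
- by rewrite -fmapM iK.1 fmap0.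
- move=> w g h igh; apply: gsec_ext => s; apply: (is_kernel_mono (iKs s)).
  have := congr1 (comp (gsec_proj F s)) igh.
  by rewrite /= !compA !gsec_liftK -!compA.
move=> w g ag0.
have ags s : sh_map a s ∘ (gsec_proj F s ∘ g) = 0.
  have := congr1 (comp (gsec_proj G s)) ag0.
  by rewrite /= compA gsec_liftK compm0 -compA.
pose c s := sval (cid ((iKs s).2 _ _ (ags s))).
have cE s : sh_map i s ∘ c s = gsec_proj F s ∘ g.
  exact: (svalP (cid ((iKs s).2 _ _ (ags s)))).1.
have cc : @compatible _ _ _ K _ c.
  move=> s t st; apply: (is_kernel_mono (iKs t)).
  by rewrite compA sh_nat -compA !cE compA (gsecP F).1.
exists (gsec_lift cc); apply: gsec_ext => s.
by rewrite /= compA gsec_liftK -compA gsec_liftK.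
Qed.

End Stalks.

(** * Inverse images along a monotone map *)

Section Pull.
Context {dP dQ : Order.disp_t} {P : finPOrderType dP} {Q : finPOrderType dQ}.
Variables (V : abcat) (f : Q -> P).
Hypothesis fm : forall s t, (s <= t)%O -> (f s <= f t)%O.
Implicit Types F G : sheaf_cat P V.

Definition pull_ob F : sheaf_cat Q V :=
  @Sheaf _ Q V (fun s => stalk F (f s))
    (fun s t st => @res _ _ _ F (f s) (f t) (fm st))
    (fun s ss => res1 F (fm ss))
    (fun s t u st tu su => resM F (fm st) (fm tu) (fm su)).

Definition pull_map F G (a : hom F G) : hom (pull_ob F) (pull_ob G) :=
  @SheafHom _ Q V (pull_ob F) (pull_ob G)
    (fun s => sh_map a (f s)) (fun s t st => sh_nat a (fm st)).

Definition pull : additive_functor (sheaf_cat P V) (sheaf_cat Q V).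
Proof.
by refine (@AdditiveFunctor (sheaf_cat P V) (sheaf_cat Q V)
  pull_ob pull_map _ _ _) => *; apply: sh_ext.
Defined.

Lemma pull_kernel F G K (a : hom F G) (i : hom K F) :
  is_kernel a i -> is_kernel (fmap pull a) (fmap pull i).
Proof. by move=> iK; apply: sh_kernelP => s; exact: sh_kernel_stalk iK. Qed.

Lemma pull_epi F G (a : hom F G) : epi a -> epi (fmap pull a).
Proof. by move=> ae; apply: sh_epiP => s; exact: sh_epi_stalk ae. Qed.

Lemma pull_mono F G (a : hom F G) : mono a -> mono (fmap pull a).
Proof. by move=> am; apply: sh_monoP => s; exact: sh_mono_stalk am. Qed.

Lemma gsec_pull_subproof F :
  @compatible _ _ _ (pull F) (gsec P V F) (fun s => gsec_proj F (f s)).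
Proof. by move=> s t st; exact: (gsecP F).1. Qed.

Definition gsec_pull F : hom (gsec P V F) (gsec Q V (pull F)) :=
  gsec_lift (gsec_pull_subproof F).

Lemma gsec_pull_nat F G (a : hom F G) :
  gsec_pull G ∘ fmap (gsec P V) a = fmap (gsec Q V) (fmap pull a) ∘ gsec_pull F.
Proof.
apply: gsec_ext => s; rewrite compA gsec_liftK /= gsec_liftK.
by rewrite compA gsec_liftK -compA gsec_liftK.
Qed.

Definition pull_preserves_coh F : Prop := preserves_coh gsec_pull F.

End Pull.

(** * Inverse images along a Galois connection *)

Section Galois.
Context {dP dQ : Order.disp_t} {P : finPOrderType dP} {Q : finPOrderType dQ}.
Variables (V : abcat) (l : P -> Q) (u : Q -> P).
Hypothesis lm : forall s t, (s <= t)%O -> (l s <= l t)%O.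
Hypothesis um : forall s t, (s <= t)%O -> (u s <= u t)%O.
Hypothesis ul : forall p, (p <= u (l p))%O.
Hypothesis lu : forall q, (l (u q) <= q)%O.
Implicit Types F G : sheaf_cat P V.
Implicit Types H J : sheaf_cat Q V.

(* The exact functor [pull V um] is left adjoint to [pull V lm]. *)
Lemma pull_left_injective J :
  injective_object J -> injective_object (pull V lm J).
Proof.
move=> JI X Y m mm f.
(* The transpose of [f] under the adjunction: its component at [u q], followed by restriction along
   [lu q]. *)
have f'n q q' (qq : (q <= q')%O) :
    (res J (lu q') ∘ sh_map f (u q')) ∘ res (pull V um X) qq =
    res J qq ∘ (res J (lu q) ∘ sh_map f (u q)).
  rewrite /= -compA; have /= -> := sh_nat f (um qq); rewrite !compA.
  by rewrite !(resM _ _ _ (le_trans (lu q) qq)).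
pose f' : hom (pull V um X) J :=
  @SheafHom _ Q V (pull V um X) J _ f'n.
have [g gE] := JI _ _ _ (pull_mono (fm := um) mm) f'.
(* The extension [g] is transposed back by means of the restrictions along [ul p]. *)
have g'n p p' (pp : (p <= p')%O) :
    (sh_map g (l p') ∘ res Y (ul p')) ∘ res Y pp =
    res (pull V lm J) pp ∘ (sh_map g (l p) ∘ res Y (ul p)).
  have /= gN := sh_nat g (lm pp).
  rewrite /= [RHS]compA -gN -!compA; congr (_ ∘ _).
  by rewrite !(resM _ _ _ (le_trans pp (ul p'))).
exists (@SheafHom _ P V Y (pull V lm J) _ g'n); apply: sh_ext => p /=.
have /= mN := sh_nat m (ul p); have /= fN := sh_nat f (ul p).
have /= gEp := congr1 (fun a : sheaf_hom (pull V um X) J => a (l p)) gE.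
rewrite -compA -mN compA gEp -compA fN compA (resM _ _ _ (lexx _)) res1.
exact: comp1m.
Qed.

(** The inverse takes at [q] the value of a section at [u q], restricted along [lu q]. *)
Lemma gsec_pull_left_iso J : is_iso (gsec_pull lm J).
Proof.
have cc : @compatible _ _ _ J (gsec P V (pull V lm J))
    (fun q => res J (lu q) ∘ gsec_proj (pull V lm J) (u q)).
  move=> q q' qq; rewrite compA (resM _ _ _ (le_trans (lu q) qq)).
  rewrite -((gsecP (pull V lm J)).1 _ _ (um qq)) compA /=.
  by rewrite (resM _ _ _ (le_trans (lu q) qq)).
exists (gsec_lift cc); split; apply: gsec_ext => q.
  rewrite compA gsec_liftK -compA gsec_liftK compm1.
  by rewrite (gsecP J).1.
rewrite compA gsec_liftK gsec_liftK compm1.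
rewrite -((gsecP (pull V lm J)).1 _ _ (ul q)) compA /=.
by rewrite (resM _ _ _ (lexx _)) res1 comp1m.
Qed.

Lemma gsec_pull_left_quasi_iso (X : complex (sheaf_cat Q V)) :
  @quasi_iso V (fmap_cx (gsec Q V) X)
    (fmap_cx (gsec P V) (fmap_cx (pull V lm) X))
    (fun n => gsec_pull lm (X n)).
Proof.
apply: iso_quasi_iso => n; last exact: gsec_pull_left_iso.
exact: gsec_pull_nat.
Qed.

(** The image of [I] is an injective resolution of the inverse image of [J] with the same global
    sections, and [phi] compares it with [K]. *)
Lemma left_preserves_coh J : pull_preserves_coh lm J.
Proof.
move=> I K phi phi0 phiC.
pose RI := fmap_resolution (@pull_kernel _ _ _ _ V _ lm)
  (@pull_epi _ _ _ _ V _ lm) (@pull_left_injective) I.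
apply: (quasi_iso_comp (gsec_pull_left_quasi_iso I)).
apply: (@resolution_quasi_iso _ _ (gsec P V) _ _ RI K (idm _)) => //.
  by exists (idm _); rewrite comp1m.
by rewrite compm1.
Qed.

(** The unit of the adjunction between [pull V um] and [pull V lm]. *)
Definition pull_unit F : hom F (pull V lm (pull V um F)).
Proof.
exists (fun p => res F (ul p)) => p p' pp /=.
by rewrite !(resM _ _ _ (le_trans pp (ul p'))).
Defined.

Lemma pull_unit_nat F G (a : hom F G) :
  pull_unit G ∘ a = fmap (pull V lm) (fmap (pull V um) a) ∘ pull_unit F.
Proof. by apply: sh_ext => p; rewrite /= sh_nat. Qed.

(** The unit at [F] is an isomorphism, so [psi] compares injective resolutions of isomorphic
    sheaves. On sections it is the map under study followed by the isomorphism [gsec_pull lm], which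
    cancels. *)
Lemma right_preserves_coh F :
  (forall p, is_iso (res F (ul p))) -> pull_preserves_coh um F.
Proof.
move=> FI I J phi phi0 phiC.
pose RJ := fmap_resolution (@pull_kernel _ _ _ _ V _ lm)
  (@pull_epi _ _ _ _ V _ lm) (@pull_left_injective) J.
pose psi n : hom (I n) (RJ n) := fmap (pull V lm) (phi n) ∘ pull_unit (I n).
have psiQ : @quasi_iso V (fmap_cx (gsec P V) I) (fmap_cx (gsec P V) RJ)
    (fun n => fmap (gsec P V) (psi n)).
  apply: (@resolution_quasi_iso _ _ (gsec P V) _ _ I RJ (pull_unit F)).
  - by apply: sh_isoP => p; exact: FI.
  - by rewrite /psi -compA pull_unit_nat compA -fmapM phi0.
  - move=> n; have phiCn : phi n.+1 ∘ fmap (pull V um) (cx_d I n) =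
      cx_d J n ∘ phi n := phiC n.
    have -> : cx_d RJ n = fmap (pull V lm) (cx_d J n) by [].
    by rewrite /psi -compA pull_unit_nat !compA -!fmapM phiCn.
apply: (@quasi_iso_cancel V (fmap_cx (gsec P V) I) (fmap_cx (gsec Q V) J)
  (fmap_cx (gsec P V) (fmap_cx (pull V lm) J)) _
  (fun n => gsec_pull lm (J n))).
- exact: (restriction_chain (@gsec_pull_nat _ _ _ _ V _ um)).
- exact: gsec_pull_left_quasi_iso.
apply: quasi_iso_cohomologous psiQ => n.
suff -> : fmap (gsec P V) (psi n) =
    gsec_pull lm (J n) ∘ (fmap (gsec Q V) (phi n) ∘ gsec_pull um (I n)).
  exact: cohomologous_refl.
(* Compatibility of the projections absorbs the restriction in [pull_unit]. *)
apply: gsec_ext => p; rewrite /= gsec_liftK /= -compA (gsecP (I n)).1.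
by rewrite !compA gsec_liftK gsec_liftK -compA gsec_liftK.
Qed.

End Galois.

Lemma pull_preserves_coh_comp (dP dQ dR : Order.disp_t) (P : finPOrderType dP)
    (Q : finPOrderType dQ) (R : finPOrderType dR) (V : abcat)
    (f : Q -> P) (g : R -> Q) (h : R -> P)
    (fm : forall s t, (s <= t)%O -> (f s <= f t)%O)
    (gm : forall s t, (s <= t)%O -> (g s <= g t)%O)
    (hm : forall s t, (s <= t)%O -> (h s <= h t)%O) (F : sheaf_cat P V) :
    h =1 f \o g -> pull_preserves_coh fm F ->
    pull_preserves_coh gm (pull V fm F) ->
  pull_preserves_coh hm F.
Proof.
move=> /funext hE; subst h => fF gF.
(* With this proof of monotonicity the inverse image along the composite is convertible to the
   iterated one, so that [I], [J] and [phi] serve for both. *)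
have <- : (fun s t st => fm _ _ (gm s t st)) = hm by exact: Prop_irrelevance.
have := preserves_coh_comp (@gsec_pull_nat _ _ _ _ V _ fm)
  (@gsec_pull_nat _ _ _ _ V _ gm) (@pull_kernel _ _ _ _ V _ fm)
  (@pull_epi _ _ _ _ V _ fm) (@pull_kernel _ _ _ _ V _ gm)
  (@pull_epi _ _ _ _ V _ gm) fF gF.
move=> + I J phi phi0 phiC; move=> /(_ I J phi phi0 phiC).
apply: quasi_iso_cohomologous => n.
suff -> : gsec_pull gm (pull V fm (I n)) ∘ gsec_pull fm (I n) =
    gsec_pull (fun s t st => fm _ _ (gm s t st)) (I n).
  exact: cohomologous_refl.
by apply: gsec_ext => s; rewrite compA !gsec_liftK.
Qed.

(** * Deletion of beat points *)

Section Deletion.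
Context {disp : Order.disp_t} {S : finPOrderType disp} {V : abcat}.
Implicit Types F : sheaf_cat S V.

(** The sheaf [pull V (@subposet_le R) F] is convertible to [restrict R F]. *)
Definition subposet_le (R : {set S}) (s t : subposet R) (st : (s <= t)%O) :
  (val s <= val t)%O := st.

Section DeletePoint.
Variables (R : {set S}) (v a : subposet R).
Hypothesis av : a != v.
Local Notation T := (R :\ val v).

Lemma deletion_subproof (s : subposet T) : val s \in R.
Proof. exact: subsetP (subD1set R (val v)) _ (valP s). Qed.

Definition deletion_inc (s : subposet T) : subposet R :=
  Sub (val s) (deletion_subproof s).

Lemma deletion_target_subproof : val a \in T.
Proof. by rewrite !inE (valP a) andbT; apply: contra av => /eqP/val_inj->. Qed.

(** [insubd] falls back on its default, the point [a], exactly at [p = v]. *)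
Definition deletion_retract (p : subposet R) : subposet T :=
  insubd (Sub (val a) deletion_target_subproof) (val p).

Lemma deletion_incK (p : subposet R) :
  deletion_inc (deletion_retract p) = if p == v then a else p.
Proof.
apply: val_inj; rewrite /= val_insubd !inE (valP p) andbT.
by rewrite (inj_eq val_inj); case: eqP.
Qed.

Lemma deletion_retractK (q : subposet T) : deletion_retract (deletion_inc q) = q.
Proof. exact: valKd. Qed.

Lemma deletion_inc_le s t : (s <= t)%O -> (deletion_inc s <= deletion_inc t)%O.
Proof. by []. Qed.

Lemma deletion_retract_le :
  (forall p, (p <= v)%O -> p != v -> (p <= a)%O) ->
  (forall p, (v <= p)%O -> p != v -> (a <= p)%O) ->
  forall p p', (p <= p')%O -> (deletion_retract p <= deletion_retract p')%O.
Proof.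
move=> le_va ge_va p p' pp.
suff : (deletion_inc (deletion_retract p) <=
        deletion_inc (deletion_retract p'))%O by [].
rewrite !deletion_incK; case: eqVneq => [pv|pv]; case: eqVneq => [p'v|p'v] //.
  by apply: ge_va => //; rewrite -pv.
by apply: le_va => //; rewrite -p'v.
Qed.

End DeletePoint.

Lemma beat_preserves_coh F (R : {set S}) (v : subposet R) :
  beat (restrict R F) v ->
  pull_preserves_coh (@deletion_inc_le R v) (pull V (@subposet_le R) F).
Proof.
case=> [[a [va [aP aI]]]|[a [av0 aP]]].
  have av : a != v by rewrite gt_eqF.
  have rle : forall p p', (p <= p')%O ->
      (deletion_retract av p <= deletion_retract av p')%O.
    apply: deletion_retract_le => p pv p_v; first exact: le_trans pv (ltW va).
    by apply: aP; rewrite lt_neqAle eq_sym p_v.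
  have ir p : (p <= deletion_inc (deletion_retract av p))%O.
    by rewrite deletion_incK; case: eqP => // ->; exact: ltW.
  (* The retraction is the left adjoint. The unit is the relation [v <= a] at [v], where the
     restriction is invertible by assumption, and an equality elsewhere. *)
  apply: (right_preserves_coh rle (ul := ir)) => [q|p].
    by rewrite deletion_retractK.
  have [pv|p_v] := eqVneq p v; last first.
    by apply: res_iso; rewrite deletion_incK (negPf p_v).
  subst p; have := deletion_incK av v; rewrite eqxx.
  (* The target is generalized together with the inequality that depends on it, so that [a] can
     replace it. *)
  move: (deletion_inc _) (ir v) => q vq qa.
  by subst q; rewrite (bool_irrelevance vq (ltW va)).
have av : a != v by rewrite lt_eqF.
(* For a downbeat the inclusion is the left adjoint, as the retraction only lowers [v] to [a]. *)
apply: (left_preserves_coh (u := deletion_retract av)) => [|q|p].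
- apply: deletion_retract_le => p pv p_v; last exact: le_trans (ltW av0) pv.
  by apply: aP; rewrite lt_neqAle p_v.
- by rewrite deletion_retractK.
by rewrite deletion_incK; case: eqP => // ->; exact: ltW.
Qed.

Lemma deletes_preserves_coh F T :
  deletes_to F T -> pull_preserves_coh (@subposet_le T) F.
Proof.
elim=> [|R v _ IH vB]; last first.
  apply: pull_preserves_coh_comp IH (beat_preserves_coh vB).
  by move=> s.
(* The full subset is a different type from [S]; its inclusion is an isomorphism of posets with
   inverse [r], hence a left adjoint of [r]. *)
pose r (s : S) : subposet [set: S] := Sub s (in_setT s).
apply: (left_preserves_coh (u := r)) => [s t|p|q]; first by [].
  exact: (lexx (val p)).
exact: lexx.
Qed.

End Deletion.

Theorem theorem1p13 (V : abcat) (disp : Order.disp_t) (S : finPOrderType disp)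
    (F : sheaf_cat S V) (T : {set S}) (hT : core_of F T) :
  (exists th : forall (j : nat) (G : sheaf_cat S V),
      hom (sheaf_coh j G) (sheaf_coh j (restrict T G)),
    delta_extension th) /\
  forall th : forall (j : nat) (G : sheaf_cat S V),
      hom (sheaf_coh j G) (sheaf_coh j (restrict T G)),
    delta_extension th -> forall j : nat, is_iso (th j F).
Proof.
have restrict_pull (G : sheaf_cat S V) :
    gsec_restrict T G = gsec_pull (@subposet_le disp S T) G.
  by apply: gsec_ext => s; rewrite !gsec_liftK.
have rho_nat (G H : sheaf_cat S V) (a : hom G H) :
    gsec_restrict T H ∘ fmap (gsec S V) a =
    fmap (gsec (subposet T) V) (fmap (restrict T) a) ∘ gsec_restrict T G.
  rewrite !restrict_pull; exact: gsec_pull_nat.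
have R_ker (G H K : sheaf_cat S V) (a : hom G H) (i : hom K G) :
    is_kernel a i -> is_kernel (fmap (restrict T) a) (fmap (restrict T) i).
  by move=> iK; apply: sh_kernelP => s; exact: sh_kernel_stalk iK.
have R_epi (G H : sheaf_cat S V) (a : hom G H) :
    epi a -> epi (fmap (restrict T) a).
  by move=> ae; apply: sh_epiP => s; exact: sh_epi_stalk ae.
pose th j G := comparison_map rho_nat R_ker R_epi j G.
have thD : delta_extension th.
  split.
  - exact: comparison_unit.
  - exact: comparison_natural.
  - by move=> *; exact: comparison_connecting.
split; first by exists th.
move=> th' [th'0 _ th'S] j; case: thD => th0 _ thS.
(* An arbitrary extension is first identified with the comparison maps [th]; the deletions leading
   from [S] to [T] then make these invertible at [F]. *)
rewrite (delta_unique (@gsec_kernel _ _ _) th'0 th0 th'S thS).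
apply: comparison_iso => I J phi phi0 phiC.
apply: quasi_iso_cohomologous (deletes_preserves_coh hT.1 phi0 phiC) => n.
by rewrite restrict_pull; exact: cohomologous_refl.
Qed.
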